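(* Let $(G,P,\theta)$ be an algebraic dynamical system with $P$ abelian and $\bigcap_{p\in P}\theta_p(G)=\{1_G\}$. If $a\in\mathcal{Q}(G\rtimes_\theta P)$ satisfies $F_{(p,q)}(a)=0$ for all $(p,q)\in P(\perp)$, then $a=0$.
   Context: An algebraic dynamical system is a triple $(G,P,\theta)$ where $G$ is a countable discrete group; $P$ is a right LCM semigroup, i.e. a countable left cancellative monoid in which the intersection of two principal right ideals is either empty or another principal right ideal; and $\theta$ is an action of $P$ on $G$ by injective group endomorphisms $\theta_p$ which respects the order: $pP\cap qP=rP$ implies $\theta_p(G)\cap\theta_q(G)=\theta_r(G)$. Write $N_p=[G:\theta_p(G)]$. An abelian $P$ is directed with respect to $p\geq q\Leftrightarrow p\in qP$. For directed $P$, the boundary quotient $\mathcal{Q}(G\rtimes_\theta P)$ is the universal $C^*$-algebra generated by a unitary representation $u$ of $G$ and a representation $s$ of the monoid $P$ by isometries satisfying (I) $s_pu_g=u_{\theta_p(g)}s_p$; (II) $s_p^*u_gs_q=u_{g_1}s_{p'}s_{q'}^*u_{g_2}$ if $g=\theta_p(g_1)\theta_q(g_2)$ and $pP\cap qP=pp'P$, $pp'=qq'$, and $s_p^*u_gs_q=0$ otherwise; (III) $\sum_{[g]\in G/\theta_p(G)}u_gs_ps_p^*u_g^*=1$ whenever $N_p<\infty$. For abelian $P$, let $T$ be the Pontryagin dual of the Grothendieck group $P^{-1}P$; the gauge action $\gamma\colon T\curvearrowright\mathcal{Q}(G\rtimes_\theta P)$ is given by $\gamma_\chi(u_gs_p)=\chi(p)u_gs_p$,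 and $\mathcal{F}$ denotes its fixed-point algebra. Let $P(\perp)=\{(p,q)\in P\times P\mid pP\cap qP=pqP\}$. For $(p,q)\in P(\perp)$ define the contractive linear map $F_{(p,q)}\colon\mathcal{Q}(G\rtimes_\theta P)\to\mathcal{F}$ by $F_{(p,q)}(a)=\int_T\gamma_\chi(s_pas_q^* )\,d\chi$, the integral being with respect to normalized Haar measure on the compact abelian group $T$. *)

(* Defs.v *)
From HB Require Import structures.
From mathcomp Require Import all_boot all_order all_algebra generic_quotient.
From mathcomp Require Import all_classical all_reals all_analysis.
From mathcomp.real_closed Require Import complex.

Set Implicit Arguments.
Unset Strict Implicit.
Unset Printing Implicit Defensive.

Import Order.TTheory GRing.Theory Num.Theory.
Import numFieldNormedType.Exports.

Local Open Scope classical_set_scope.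
Local Open Scope ring_scope.
Local Open Scope complex_scope.
Local Open Scope quotient_scope.

(* In MathComp-Analysis the norm of a normed space over R[i] takes its values
   in R[i] (in the nonnegative reals, for the order of R[i]).
   The ring structure cannot be joined with the normed one by inheritance
   (numDomainType already sits below both), so the product is part of the mixin
   and the ring and algebra structures are derived from it. *)
HB.mixin Record isCStarAlgebra (R : realType) A
    & CompleteNormedModule R[i] A := {
  cstar_one : A;
  cstar_mul : A -> A -> A;
  star : A -> A;
  cstar_mulA : associative cstar_mul;
  cstar_mul1l : left_id cstar_one cstar_mul;
  cstar_mul1r : right_id cstar_one cstar_mul;
  cstar_mulDl : left_distributive cstar_mul +%R;
  cstar_mulDr : right_distributive cstar_mul +%R;
  cstar_one_neq0 : cstar_one != 0;
  cstar_scaleAl : forall (c : R[i]) (a b : A),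
    c *: cstar_mul a b = cstar_mul (c *: a) b;
  cstar_scaleAr : forall (c : R[i]) (a b : A),
    c *: cstar_mul a b = cstar_mul a (c *: b);
  starK : involutive star;
  starD : {morph star : a b / a + b};
  starZ : forall (c : R[i]) (a : A), star (c *: a) = c^* *: star a;
  starM_subproof : forall a b : A,
    star (cstar_mul a b) = cstar_mul (star b) (star a);
  cstar_normM_subproof : forall a b : A, `|cstar_mul a b| <= `|a| * `|b|;
  cstar_normE_subproof : forall a : A,
    `|cstar_mul (star a) a| = `|a| ^+ 2;
}.

#[short(type="cstarAlgType")]
HB.structure Definition CStarAlgebra (R : realType) :=
  {A of CompleteNormedModule R[i] A & isCStarAlgebra R A}.

Section CStarAlgebraRing.
Variables (R : realType) (A : cstarAlgType R).

HB.instance Definition _ := @GRing.Zmodule_isNzRing.Build A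
  (@cstar_one R A) (@cstar_mul R A) (@cstar_mulA R A) (@cstar_mul1l R A)
  (@cstar_mul1r R A) (@cstar_mulDl R A) (@cstar_mulDr R A)
  (@cstar_one_neq0 R A).
HB.instance Definition _ :=
  GRing.Lmodule_isLalgebra.Build R[i] A (@cstar_scaleAl R A).
HB.instance Definition _ :=
  GRing.Lalgebra_isAlgebra.Build R[i] A (@cstar_scaleAr R A).

Lemma starM (a b : A) : star (a * b) = star b * star a.
Proof. exact: starM_subproof. Qed.

Lemma cstar_normM (a b : A) : `|a * b| <= `|a| * `|b|.
Proof. exact: cstar_normM_subproof. Qed.

Lemma cstar_normE (a : A) : `|star a * a| = `|a| ^+ 2.
Proof. exact: cstar_normE_subproof. Qed.

End CStarAlgebraRing.

(* A unital *-homomorphism is an lrmorphism that satisfies star_preserving;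
   its continuity is automatic and not part of the definition. *)
Definition star_preserving (R : realType) (A B : cstarAlgType R) (f : A -> B) :=
  {morph f : a / star a}.

Record closed_star_subalgebra (R : realType) (A : cstarAlgType R)
    (S : set A) : Prop := {
  css_closed : closed S;
  css_add : forall a b, S a -> S b -> S (a + b);
  css_scale : forall (c : R[i]) a, S a -> S (c *: a);
  css_mul : forall a b, S a -> S b -> S (a * b);
  css_star : forall a, S a -> S (star a);
}.

Section Bochner.
Context d (T : measurableType d) (R : realType).
Variables (mu : {measure set T -> \bar R}) (A : completeNormedModType R[i]).

(* A list of pairs (E, v) stands for the sum of the functions \1_E *: v. *)
Definition simple_fun (s : seq (set T * A)) (x : T) : A :=
  \sum_(Ev <- s | x \in Ev.1) Ev.2.

Definition simple_int (s : seq (set T * A)) : A :=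
  \sum_(Ev <- s) (fine (mu Ev.1))%:C *: Ev.2.

Definition is_bochner (f : T -> A) (y : A) : Prop :=
  exists s : nat -> seq (set T * A),
    [/\ forall n Ev, Ev \in s n -> measurable Ev.1,
        forall x, simple_fun (s n) x @[n --> \oo] --> f x,
        (\int[mu]_x (complex.Re `|f x - simple_fun (s n) x|)%:E)%E
          @[n --> \oo] --> 0%E
      & simple_int (s n) @[n --> \oo] --> y].

(* For finite mu the limit y is unique; the value 0 is taken when f is not
   integrable, which does not happen for a continuous f on a compact metrizable
   space. *)
Definition bochner (f : T -> A) : A := xget 0 [set y | is_bochner f y].

End Bochner.

Record dual (R : realType) (H : groupType) := Dual {
  dual_fun :> H -> R[i];
  dualM : forall x y, dual_fun (x * y)%g = dual_fun x * dual_fun y;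
  dual_norm : forall x, `|dual_fun x| = 1;
}.

Section DualGroup.
Variables (R : realType) (H : groupType).
Implicit Types chi psi : dual R H.

HB.instance Definition _ := gen_eqMixin (dual R H).
HB.instance Definition _ := gen_choiceMixin (dual R H).

Lemma dual_ext chi psi : chi =1 psi -> chi = psi.
Proof.
case: chi psi => [f fM f1] [g gM g1] /= /funext fg; subst g.
by congr Dual; exact: Prop_irrelevance.
Qed.

Lemma dual_neq0 chi x : chi x != 0.
Proof. by rewrite -normr_gt0 dual_norm. Qed.

Lemma dual1 chi : chi 1%g = 1.
Proof. by apply: (mulfI (dual_neq0 chi 1%g)); rewrite -dualM mulg1 mulr1. Qed.

Fact dual_one_M (x y : H) : (1 : R[i]) = 1 * 1.
Proof. by rewrite mulr1. Qed.
Definition dual_one : dual R H :=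
  @Dual R H (fun=> 1) dual_one_M (fun=> normr1 _).

Fact dual_mul_M chi psi x y :
  chi (x * y)%g * psi (x * y)%g = (chi x * psi x) * (chi y * psi y).
Proof. by rewrite !dualM mulrACA. Qed.
Fact dual_mul_norm chi psi x : `|chi x * psi x| = 1.
Proof. by rewrite normrM !dual_norm mulr1. Qed.
Definition dual_mul chi psi : dual R H :=
  @Dual R H (fun x => chi x * psi x) (dual_mul_M chi psi)
    (dual_mul_norm chi psi).

Fact dual_inv_M chi x y : (chi (x * y)%g)^-1 = (chi x)^-1 * (chi y)^-1.
Proof. by rewrite dualM invfM. Qed.
Fact dual_inv_norm chi x : `|(chi x)^-1| = 1.
Proof. by rewrite normfV dual_norm invr1. Qed.
Definition dual_inv chi : dual R H :=
  @Dual R H (fun x => (chi x)^-1) (dual_inv_M chi) (dual_inv_norm chi).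

Lemma dual_mulA : associative dual_mul.
Proof. by move=> f g h; apply: dual_ext => x /=; rewrite mulrA. Qed.
Lemma dual_mul1g : left_id dual_one dual_mul.
Proof. by move=> f; apply: dual_ext => x /=; rewrite mul1r. Qed.
Lemma dual_mulg1 : right_id dual_one dual_mul.
Proof. by move=> f; apply: dual_ext => x /=; rewrite mulr1. Qed.
Lemma dual_mulVg : left_inverse dual_one dual_inv dual_mul.
Proof. by move=> f; apply: dual_ext => x /=; rewrite mulVf ?dual_neq0. Qed.
Lemma dual_mulgV : right_inverse dual_one dual_inv dual_mul.
Proof. by move=> f; apply: dual_ext => x /=; rewrite mulfV ?dual_neq0. Qed.

HB.instance Definition _ := isGroup.Build (dual R H)
  dual_mulA dual_mul1g dual_mulg1 dual_mulVg dual_mulgV.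
HB.instance Definition _ := isPointed.Build (dual R H) dual_one.

(* H being discrete, its compact-open topology is pointwise convergence. *)
HB.instance Definition _ := Topological.copy (dual R H)
  (initial_topology
     (fun chi => (dual_fun chi : prod_topology (fun _ : H => R[i]^o)))).

End DualGroup.

Definition borel (T : ptopologicalType) := g_sigma_algebraType (@open T).

(* For countable H the dual is compact metrizable, so that every Borel
   probability measure on it is regular. *)
Definition is_haar (R : realType) (H : groupType)
    (mu : probability (borel (dual R H)) R) : Prop :=
  forall (chi : dual R H) (E : set (borel (dual R H))), measurable E ->
    mu ((fun psi : dual R H => (chi * psi)%g) @^-1` E) = mu E.

HB.mixin Record Monoid_isCommutative P & Monoid P := {
  mulgC : commutative (@monoid.mul P)
}.

#[short(type="comMonoidType")]
HB.structure Definition ComMonoid := {P of Monoid P & Monoid_isCommutative P}.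

Section Grothendieck.
Variable P : comMonoidType.

(* The pair (p, q) stands for the fraction q^-1 p. *)
Definition groth_rel (x y : P * P) : bool :=
  `[< exists k : P, (k * (x.1 * y.2) = k * (y.1 * x.2))%g >].

HB.instance Definition _ :=
  SemiGroup.isCommutativeLaw.Build P (@monoid.mul P) (@mulgC P).

Lemma groth_refl : reflexive groth_rel.
Proof. by move=> x; apply/asboolP; exists 1%g. Qed.

Lemma groth_sym : symmetric groth_rel.
Proof.
by move=> x y; apply/asboolP/asboolP => -[k kE]; exists k.
Qed.

Lemma groth_trans : transitive groth_rel.
Proof.
move=> y x z /asboolP[k kE] /asboolP[l lE]; apply/asboolP.
exists (k * l * y.2)%g.
have -> : (k * l * y.2 * (x.1 * z.2) = k * (x.1 * y.2) * (l * z.2))%g.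
  by rewrite [LHS](AC (3*2) ((1*(4*3))*(2*5))).
have -> : (k * l * y.2 * (z.1 * x.2) = l * (z.1 * y.2) * (k * x.2))%g.
  by rewrite [LHS](AC (3*2) ((2*(4*3))*(1*5))).
by rewrite kE -lE [LHS](AC ((1*2)*2) ((4*(2*5))*(1*3))).
Qed.

Canonical groth_equiv := EquivRel groth_rel groth_refl groth_sym groth_trans.

Definition groth := {eq_quot groth_equiv}.

HB.instance Definition _ := Choice.on groth.
HB.instance Definition _ := EqQuotient.on groth.

Definition groth_one : groth := \pi_groth (1%g, 1%g).
Definition groth_mul (x y : groth) : groth :=
  \pi_groth ((repr x).1 * (repr y).1, (repr x).2 * (repr y).2)%g.
Definition groth_inv (x : groth) : groth :=
  \pi_groth ((repr x).2, (repr x).1).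

Definition groth_in (p : P) : groth := \pi_groth (p, 1%g).


Lemma groth_eqP (x y : P * P) :
  reflect (exists k : P, (k * (x.1 * y.2) = k * (y.1 * x.2))%g)
          (\pi_groth x == \pi_groth y).
Proof. by rewrite piE; apply: asboolP. Qed.

Lemma groth_repr (x : P * P) :
  exists k : P, (k * ((repr (\pi_groth x)).1 * x.2) =
                 k * (x.1 * (repr (\pi_groth x)).2))%g.
Proof. by apply/groth_eqP; rewrite reprK. Qed.

Lemma grothW (Q : groth -> Prop) :
  (forall x : P * P, Q (\pi_groth x)) -> forall x, Q x.
Proof. by move=> QP x; rewrite -[x]reprK. Qed.

Lemma groth_mul_pi (x y : P * P) :
  groth_mul (\pi_groth x) (\pi_groth y)
    = \pi_groth (x.1 * y.1, x.2 * y.2)%g.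
Proof.
have [k kE] := groth_repr x; have [l lE] := groth_repr y.
apply/eqP/groth_eqP; exists (k * l)%g => /=.
rewrite [LHS](AC (2*(2*2)) ((1*(3*5))*(2*(4*6)))) /=.
by rewrite kE lE [LHS](AC ((1*2)*(1*2)) ((1*4)*((2*5)*(3*6)))).
Qed.

Lemma groth_inv_pi (x : P * P) :
  groth_inv (\pi_groth x) = \pi_groth (x.2, x.1).
Proof.
have [k kE] := groth_repr x; apply/eqP/groth_eqP; exists k => /=.
by rewrite (mulgC _ x.1) -kE (mulgC x.2).
Qed.

Lemma groth_mulA : associative (@groth_mul).
Proof.
elim/grothW=> x; elim/grothW=> y; elim/grothW=> z.
by rewrite !groth_mul_pi /= !mulgA.
Qed.

Lemma groth_mul1g : left_id groth_one groth_mul.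
Proof. by elim/grothW=> -[x1 x2]; rewrite groth_mul_pi /= !mul1g. Qed.

Lemma groth_mulg1 : right_id groth_one groth_mul.
Proof. by elim/grothW=> -[x1 x2]; rewrite groth_mul_pi /= !mulg1. Qed.

Lemma groth_mulVg : left_inverse groth_one groth_inv groth_mul.
Proof.
elim/grothW=> x; rewrite groth_inv_pi groth_mul_pi; apply/eqP/groth_eqP.
by exists 1%g; rewrite /= !mulg1 !mul1g mulgC.
Qed.

Lemma groth_mulgV : right_inverse groth_one groth_inv groth_mul.
Proof.
elim/grothW=> x; rewrite groth_inv_pi groth_mul_pi; apply/eqP/groth_eqP.
by exists 1%g; rewrite /= !mulg1 !mul1g mulgC.
Qed.

HB.instance Definition _ := isGroup.Build groth
  groth_mulA groth_mul1g groth_mulg1 groth_mulVg groth_mulgV.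

Lemma groth_inM p q : groth_in (p * q)%g = (groth_in p * groth_in q)%g.
Proof. by rewrite [RHS]groth_mul_pi /= mulg1. Qed.

End Grothendieck.

Definition principal (P : monoidType) (p : P) : set P :=
  range (fun x => p * x)%g.

Record right_LCM (P : monoidType) : Prop := {
  rlcm_countable : countable [set: P];
  rlcm_cancel : forall p x y : P, (p * x = p * y)%g -> x = y;
  rlcm_lcm : forall p q : P, principal p `&` principal q = set0 \/
    exists r, principal p `&` principal q = principal r;
}.

Record algebraic_dynamical_system (G : groupType) (P : monoidType)
    (theta : P -> G -> G) : Prop := {
  ads_countable : countable [set: G];
  ads_right_LCM : right_LCM P;
  ads_hom : forall p g h, theta p (g * h)%g = (theta p g * theta p h)%g;
  ads_inj : forall p, injective (theta p);
  ads_act1 : forall g, theta 1%g g = g;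
  ads_actM : forall p q g, theta (p * q)%g g = theta p (theta q g);
  ads_order : forall p q r, principal p `&` principal q = principal r ->
    range (theta p) `&` range (theta q) = range (theta r);
}.

Definition cosets (G : groupType) (P : monoidType) (theta : P -> G -> G)
    (p : P) : set (set G) :=
  [set X | exists g : G, X = range (fun h => g * theta p h)%g].

Section BoundaryQuotient.
Variables (R : realType) (G : groupType) (P : monoidType).
Variable theta : P -> G -> G.

Record boundary_representation (A : cstarAlgType R) (u : G -> A) (s : P -> A)
    : Prop := {
  br_u1 : u 1%g = 1;
  br_uM : forall g h, u (g * h)%g = u g * u h;
  br_uV : forall g, star (u g) * u g = 1 /\ u g * star (u g) = 1;
  br_s1 : s 1%g = 1;
  br_sM : forall p q, s (p * q)%g = s p * s q;
  br_isometry : forall p, star (s p) * s p = 1;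
  br_I : forall p g, s p * u g = u (theta p g) * s p;
  br_II : forall p q g g1 g2 p' q', g = (theta p g1 * theta q g2)%g ->
    principal p `&` principal q = principal (p * p')%g ->
    (p * p' = q * q')%g ->
    star (s p) * u g * s q = u g1 * s p' * star (s q') * u g2;
  br_II0 : forall p q g,
    ~ (exists g1 g2 p' q', [/\ g = (theta p g1 * theta q g2)%g,
        principal p `&` principal q = principal (p * p')%g &
        (p * p' = q * q')%g]) ->
    star (s p) * u g * s q = 0;
  (* By br_I the summand does not depend on the representative of X. *)
  br_III : forall p, finite_set (cosets theta p) ->
    \sum_(X \in cosets theta p)
      (u (xget 1%g X) * s p * star (s p) * star (u (xget 1%g X))) = 1;
}.

(* Meant for directed P only, as for every commutative P; for other P the
   boundary quotient has further relations. *)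
Record boundary_quotient (A : cstarAlgType R) (u : G -> A) (s : P -> A)
    : Prop := {
  bq_rep : boundary_representation u s;
  bq_generated : forall S : set A, closed_star_subalgebra S ->
    (forall g, S (u g)) -> (forall p, S (s p)) -> S = setT;
  bq_universal : forall (B : cstarAlgType R) (v : G -> B) (t : P -> B),
    boundary_representation v t ->
    exists pi : {lrmorphism A -> B},
      [/\ star_preserving pi, forall g, pi (u g) = v g
        & forall p, pi (s p) = t p];
}.

End BoundaryQuotient.

Section Gauge.
Variables (R : realType) (G : groupType) (P : comMonoidType).
Variables (A : cstarAlgType R) (u : G -> A) (s : P -> A).

Definition gauge_group := dual R (groth P).

(* gauge_gen determines gamma when u and s generate A, and then gamma is
   strongly continuous. *)
Record gauge_action (gamma : gauge_group -> {lrmorphism A -> A}) : Prop := {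
  gauge_star : forall chi, star_preserving (gamma chi);
  gauge1 : forall a, gamma 1%g a = a;
  gaugeM : forall (chi psi : gauge_group) a,
    gamma (chi * psi)%g a = gamma chi (gamma psi a);
  gauge_gen : forall (chi : gauge_group) g p,
    gamma chi (u g * s p) = chi (groth_in p) *: (u g * s p);
}.

Definition fixed_point_algebra (gamma : gauge_group -> {lrmorphism A -> A})
  : set A := [set a | forall chi, gamma chi a = a].

(* Its values lie in fixed_point_algebra gamma. *)
Definition gauge_F (mu : probability (borel gauge_group) R)
    (gamma : gauge_group -> {lrmorphism A -> A}) (p q : P) (a : A) : A :=
  bochner mu (fun chi : borel gauge_group => gamma chi (s p * a * star (s q))).

End Gauge.

Definition perp (P : monoidType) : set (P * P) :=
  [set pq | principal pq.1 `&` principal pq.2 = principal (pq.1 * pq.2)%g].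

(* Main.v *)
Require Import Defs.
From HB Require Import structures.
From mathcomp Require Import all_boot all_order all_algebra generic_quotient.
From mathcomp Require Import all_classical all_reals all_analysis.
From mathcomp.real_closed Require Import complex.
From mathcomp Require Import measurable_realfun lra ring.

(** The idea is that the maps F_(p,q) compute the Fourier coefficients of a with
    respect to the gauge action, and that these coefficients determine a.

    For x in the Grothendieck group, the Fourier coefficient a_x is the integral
    of chi(x) gamma_chi(a) over the dual T. Every x is a fraction p / q with (p,
    q) in P(perp) ([perp_fraction]): reduce an arbitrary fraction with a least
    common multiple. For such p and q one has F_(p,q)(a) = s_p a_x s_q^*, whence
    a_x = s_p^* F_(p,q)(a) s_q since s_p and s_q are isometries. So the
    hypothesis says exactly that all Fourier coefficients of a vanish
    ([fourier_coef_eq0]).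

    It remains to see that a = 0 ([fourier_uniqueness]). The linear combinations
    of spectral elements, those on which each gamma_chi acts as the scalar
    chi(x) for some x, are dense, because u and s generate the algebra and are
    spectral ([spectral_span_dense]). Since the gamma_chi are uniformly bounded
    ([star_hom_bounded]), a - gamma_chi(a) is small as soon as chi(x) is close
    to 1 for the finitely many x that occur in an approximation of a. A product
    K of Fejer kernels is nonnegative and concentrated on such chi
    ([fejer_prod_concentrated]); being a finite sum of characters, it satisfies
    \int K(chi) gamma_chi(a) = 0, so that (\int K) |a| <= \int K(chi) |a -
    gamma_chi(a)|, where the right-hand side is an arbitrarily small multiple of
    \int K. The concentration of K is an elementary consequence of the fact that
    the integral of a character is 0 or 1, which follows from invariance
    ([haar_character]).

    Vector-valued integrals are handled with uniform limits of simple functions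
    ([unif_int]). All integrands above are of this kind
    ([gauge_orbit_integrable]), and their integrals agree with the Bochner
    integral, which is unique ([unif_int_bochner], [bochner_unif_int]). *)

Set Implicit Arguments.
Unset Strict Implicit.
Unset Printing Implicit Defensive.

Import Order.TTheory GRing.Theory Num.Theory.
Import numFieldNormedType.Exports.

Local Open Scope classical_set_scope.
Local Open Scope ring_scope.

(** * Real-valued norms *)

Section RealNorm.
Local Open Scope complex_scope.
Context {R : realType}.

(** The norm of a normed space over the complex numbers is itself a complex
    number; its real part carries the same information and lives in an ordered
    field. *)
Definition nrm (V : normedModType R[i]) (v : V) : R := complex.Re `|v|.

Definition cabs (c : R[i]) : R := complex.Re `|c|.

Lemma cabsE (c : R[i]) : `|c| = (cabs c)%:C.
Proof. by rewrite /cabs RRe_real// ger0_real. Qed.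

Section NormedModule.
Variable V : normedModType R[i].
Implicit Types v w : V.

Lemma nrmE v : `|v| = (nrm v)%:C.
Proof. by rewrite /nrm RRe_real// ger0_real. Qed.

Lemma nrm_ge0 v : 0 <= nrm v.
Proof. by rewrite -ler0c -nrmE. Qed.

Lemma nrm0 : nrm (0 : V) = 0.
Proof. by rewrite /nrm normr0. Qed.

Lemma nrm0_eq0 v : nrm v = 0 -> v = 0.
Proof. by move=> v0; apply/eqP; rewrite -normr_eq0 nrmE v0. Qed.

Lemma nrmN v : nrm (- v) = nrm v.
Proof. by rewrite /nrm normrN. Qed.

Lemma nrmD v w : nrm (v + w) <= nrm v + nrm w.
Proof. by rewrite -lecR rmorphD /= -!nrmE ler_normD. Qed.

Lemma nrmB v w : nrm (v - w) <= nrm v + nrm w.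
Proof. by rewrite -[nrm w]nrmN nrmD. Qed.

Lemma nrm_dist v w : nrm (v - w) = nrm (w - v).
Proof. by rewrite -nrmN opprB. Qed.

Lemma nrm_tri w v v' : nrm (v - v') <= nrm (v - w) + nrm (w - v').
Proof. by rewrite -[v - v'](subrKA w) nrmD. Qed.

Lemma nrmZ c v : nrm (c *: v) = cabs c * nrm v.
Proof. by apply/complexI; rewrite -nrmE normrZ rmorphM /= -cabsE -nrmE. Qed.

Lemma nrm_sum I (r : seq I) (f : I -> V) :
  nrm (\sum_(i <- r) f i) <= \sum_(i <- r) nrm (f i).
Proof.
elim: r => [|i r IH]; first by rewrite !big_nil nrm0.
by rewrite !big_cons (le_trans (nrmD _ _))// lerD2l.
Qed.

Lemma nrm_small v (C : R) : (forall e : R, 0 < e -> nrm v <= C * e) -> v = 0.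
Proof.
move=> ve; apply: nrm0_eq0; apply/eqP; rewrite eq_le nrm_ge0 andbT.
apply/ler_addgt0Pr => e e0; rewrite add0r.
have := ve (e / (`|C| + 1)) _.
have h : 0 < `|C| + 1 by rewrite ltr_wpDl.
move=> /(_ (divr_gt0 e0 h))/le_trans; apply.
rewrite mulrCA (ler_piMr (ltW e0))// ler_pdivrMr// mul1r.
by rewrite (le_trans (ler_norm _))// lerDl.
Qed.

End NormedModule.

Lemma cabsM (c c' : R[i]) : cabs (c * c') = cabs c * cabs c'.
Proof. by apply/complexI; rewrite -cabsE normrM rmorphM /= -!cabsE. Qed.

Lemma cabs_real (r : R) : cabs r%:C = `|r|.
Proof. by rewrite /cabs normc_def /= expr0n /= addr0 sqrtr_sqr. Qed.

Lemma cabs1 (c : R[i]) : `|c| = 1 -> cabs c = 1.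
Proof. by rewrite /cabs => ->. Qed.

End RealNorm.

Section Complete.
Local Open Scope complex_scope.
Context {R : realType}.

Lemma cvg_nrmP (V : normedModType R[i]) (w : nat -> V) (l : V) :
  w n @[n --> \oo] --> l <->
  (forall e : R, 0 < e -> exists N, forall n, (N <= n)%N -> nrm (w n - l) <= e).
Proof.
split=> [/cvgrPdist_le wl e e0|wl].
  have /= := wl e%:C; rewrite ltcR => /(_ e0)[N _ Nw]; exists N => n /Nw.
  by rewrite /= nrm_dist nrmE lecR.
apply/cvgrPdist_le => e e0.
have eE : e = (complex.Re e)%:C by rewrite RRe_real// gtr0_real.
have [|N Nw] := wl (complex.Re e); first by rewrite -ltcR -eE.
exists N => // n /= /Nw; rewrite eE.
by rewrite nrm_dist nrmE lecR.
Qed.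

Lemma half_small (C e : R) : 0 < e -> exists n, C * 2^-1 ^+ n <= e.
Proof.
move=> e0; have := @cvg_geometric R C 2^-1.
rewrite ger0_norm; last by rewrite invr_ge0.
rewrite invf_lt1// ltr1n => /(_ isT)/cvgrPdist_le/(_ e e0)[N _]/(_ N (leqnn N)) /= h.
exists N; apply: le_trans h.
by rewrite sub0r normrN ler_norm.
Qed.
(** The rate is explicit so that properties of the terms can be compared with
    those of the limit. *)
Lemma complete_fast (V : completeNormedModType R[i]) (w : nat -> V) (C : R) :
  (forall n, nrm (w n.+1 - w n) <= C * 2^-1 ^+ n) ->
  exists l, forall n, nrm (w n - l) <= 2 * C * 2^-1 ^+ n.
Proof.
move=> wC.
have C0 : 0 <= C by have := wC 0%N; rewrite expr0 mulr1; apply: le_trans (nrm_ge0 _).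
have w2 n k : nrm (w (n + k)%N - w n) <= 2 * C * 2^-1 ^+ n * (1 - 2^-1 ^+ k).
  elim: k => [|k IH]; first by rewrite addn0 subrr nrm0 subrr mulr0.
  rewrite addnS (le_trans (nrm_tri (w (n + k)%N) _ _))//.
  rewrite (le_trans (lerD (wC _) IH))// exprD exprS.
  by rewrite le_eqVlt; apply/orP; left; apply/eqP; field.
have w2' n m : (n <= m)%N -> nrm (w m - w n) <= 2 * C * 2^-1 ^+ n.
  move=> /subnKC <-; apply: le_trans (w2 _ _) _.
  apply: ler_piMr; first by rewrite !mulr_ge0// exprn_ge0.
  by rewrite gerBl exprn_ge0.
have /cauchy_cvgP wc : cauchy (w n @[n --> \oo]).
  apply/cauchyP => /= e e0.
  have eE : e = (complex.Re e)%:C by rewrite RRe_real// gtr0_real.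
  have [|n nE] := @half_small (2 * C) (complex.Re e / 2).
    by rewrite divr_gt0// -ltcR -eE.
  exists (w n); exists n => // m /= nm.
  rewrite -ball_normE /= eE -normrN opprB nrmE ltcR.
  rewrite (le_lt_trans (w2' _ _ nm))// (le_lt_trans nE)//.
  by rewrite ltr_pdivrMr// ltr_pMr ?ltr1n// -ltcR -eE.
move: wc => /cvg_ex[l /cvg_nrmP wl]; exists l => n.
apply/ler_addgt0Pr => e e0; have [N Nw] := wl _ e0.
rewrite (le_trans (nrm_tri (w (maxn n N)) _ _))// lerD//.
  by rewrite nrm_dist w2'// leq_maxl.
by rewrite Nw// leq_maxr.
Qed.

End Complete.

(** * Boundedness of *-homomorphisms *)

Section CStarNorm.
Local Open Scope complex_scope.
Context {R : realType} {A : cstarAlgType R}.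
Implicit Types a b : A.

Lemma nrmM a b : nrm (a * b) <= nrm a * nrm b.
Proof. by rewrite -lecR rmorphM /= -!nrmE cstar_normM. Qed.

Lemma nrm_starM a : nrm (star a * a) = nrm a ^+ 2.
Proof. by apply: complexI; rewrite rmorphXn /= -!nrmE cstar_normE. Qed.

Lemma star1 : star (1 : A) = 1.
Proof. by rewrite -[LHS]mulr1 -{2}[1 in LHS](starK (1 : A)) -starM mulr1 starK. Qed.

Lemma star0 : star (0 : A) = 0.
Proof. by apply: (addrI (star 0)); rewrite -starD !addr0. Qed.

Lemma starN a : star (- a) = - star a.
Proof. by apply: (addrI (star a)); rewrite -starD !subrr star0. Qed.

Lemma nrm_star a : nrm (star a) = nrm a.
Proof.
have le b : nrm b <= nrm (star b).
  have [->|b0] := eqVneq (nrm b) 0; first exact: nrm_ge0.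
  have bgt0 : 0 < nrm b by rewrite lt_def b0 nrm_ge0.
  by rewrite -(ler_pM2r bgt0) -expr2 -nrm_starM nrmM.
by apply/eqP; rewrite eq_le le andbT -{2}[a]starK le.
Qed.

Lemma nrm_unitary a : star a * a = 1 -> nrm a <= 1.
Proof.
have n1 : nrm (1 : A) <= 1.
  have := nrm_starM 1; rewrite star1 mulr1 => /eqP.
  rewrite -subr_eq0 expr2 -{1}[nrm (1 : A)]mulr1 -mulrBr mulf_eq0 subr_eq0.
  by case/orP => /eqP; [move=> ->|move=> <-].
move=> aa; have := nrm_starM a; rewrite aa => a2.
rewrite -(@ler_pXn2r _ 2) ?nnegrE ?nrm_ge0//.
by rewrite -a2 expr1n.
Qed.

End CStarNorm.

Section SquareRoot.
Local Open Scope complex_scope.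
Context {R : realType} {A : cstarAlgType R}.
Variable h : A.
Hypotheses (hstar : star h = h) (hsmall : nrm h <= 2^-1).

Let half : R[i] := (2^-1)%:C.

Let cabs_half : cabs half = 2^-1.
Proof. by rewrite cabs_real ger0_norm// invr_ge0. Qed.

Fixpoint sqrt_iter n : A :=
  if n is n'.+1 then half *: (h * h + sqrt_iter n' * sqrt_iter n') else 0.

Let sqrt_iter_le n : nrm (sqrt_iter n) <= 2^-1.
Proof.
elim: n => [|n IH] /=; first by rewrite nrm0 invr_ge0.
rewrite nrmZ cabs_half ler_piMr ?invr_ge0//.
have sq (a : A) : nrm a <= 2^-1 -> nrm (a * a) <= 2^-1 * 2^-1.
  by move=> a2; rewrite (le_trans (nrmM _ _))// ler_pM ?nrm_ge0.
by rewrite (le_trans (nrmD _ _))// (le_trans (lerD (sq _ hsmall) (sq _ IH)))//; lra.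
Qed.

Let sqrt_iter_star n : star (sqrt_iter n) = sqrt_iter n.
Proof.
elim: n => [|n IH] /=; first exact: star0.
by rewrite starZ starD !starM hstar IH conj_Creal// complex_real.
Qed.

Let sqrt_iter_comm n : h * sqrt_iter n = sqrt_iter n * h.
Proof.
elim: n => [|n IH] /=; first by rewrite mulr0 mul0r.
by rewrite -scalerAr -scalerAl mulrDr mulrDl !mulrA IH -(mulrA (sqrt_iter n) h) IH mulrA.
Qed.

Let sqrt_iter_comm2 n m : sqrt_iter n * sqrt_iter m = sqrt_iter m * sqrt_iter n.
Proof.
have hc a : h * a = a * h -> sqrt_iter n * a = a * sqrt_iter n.
  move=> ha; elim: n => [|k IH] /=; first by rewrite mulr0 mul0r.
  rewrite -scalerAr -scalerAl mulrDr mulrDl.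
  by rewrite -(mulrA h) ha (mulrA h) ha -!mulrA IH (mulrA _ a) IH !mulrA.
exact/hc/sqrt_iter_comm.
Qed.

Let sqrt_iter_step n : nrm (sqrt_iter n.+1 - sqrt_iter n) <= 1 * 2^-1 ^+ n.
Proof.
rewrite mul1r; elim: n => [|n IH].
  rewrite expr0 (le_trans (nrmB _ _))// (le_trans (lerD (sqrt_iter_le _) (sqrt_iter_le _)))//.
  by lra.
have -> : sqrt_iter n.+2 - sqrt_iter n.+1 =
  half *: ((sqrt_iter n.+1 + sqrt_iter n) * (sqrt_iter n.+1 - sqrt_iter n)).
  rewrite [in LHS]/= -/(sqrt_iter n.+1) -scalerBr; congr (_ *: _).
  rewrite mulrDl !mulrBr [sqrt_iter n * sqrt_iter n.+1]sqrt_iter_comm2.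
  by rewrite addrA subrK opprD addrACA subrr add0r.
rewrite nrmZ cabs_half exprS ler_pM2l ?invr_gt0// (le_trans (nrmM _ _))//.
rewrite -[leRHS]mul1r ler_pM ?nrm_ge0//.
by rewrite (le_trans (nrmD _ _))// (le_trans (lerD (sqrt_iter_le _) (sqrt_iter_le _)))//; lra.
Qed.

(** For a self-adjoint h of norm at most 1/2, the element 1 - h^2 has a
    self-adjoint square root k = 1 - w commuting with h. The equation (1 - w)^2
    = 1 - h^2 reads w = (h^2 + w^2) / 2, and on the ball of radius 1/2 the
    right-hand side is a contraction of ratio 1/2; its iterates from 0 are
    polynomials in h, whence self-adjointness and commutation pass to the limit. *)
Lemma sqrt_one_sub_sqr : exists k : A,
  [/\ star k = k, h * k = k * h & h * h + k * k = 1].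
Proof.
have [w wl] := complete_fast sqrt_iter_step.
have wle n : nrm (sqrt_iter n - w) <= 2 * 2^-1 ^+ n by have := wl n; rewrite mulr1.
have wsm e : 0 < e -> exists n, nrm (sqrt_iter n - w) <= e /\ nrm (sqrt_iter n.+1 - w) <= e.
  move=> e0; have [n nE] := half_small 2 e0; exists n.
  split; apply: (le_trans (wle _)); apply: le_trans nE => //.
  by rewrite ler_pM2l// exprS ler_piMl ?exprn_ge0// invf_le1// ler1n.
have ws : star w = w.
  apply/eqP; rewrite -subr_eq0; apply/eqP; apply: (@nrm_small _ _ _ 2) => e e0.
  have [n [nE _]] := wsm _ e0.
  rewrite (le_trans (nrm_tri (sqrt_iter n) _ _))// mulr_natl lerD//.
  by rewrite -{1}[sqrt_iter n]sqrt_iter_star -starN -starD nrm_star nrm_dist.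
have wh : h * w = w * h.
  apply/eqP; rewrite -subr_eq0; apply/eqP.
  apply: (@nrm_small _ _ _ (nrm h + nrm h)) => e e0; have [n [nE _]] := wsm _ e0.
  rewrite (le_trans (nrm_tri (h * sqrt_iter n) _ _))// mulrDl lerD//.
    by rewrite -mulrBr (le_trans (nrmM _ _))// ler_wpM2l ?nrm_ge0// nrm_dist.
  by rewrite sqrt_iter_comm -mulrBl (le_trans (nrmM _ _))// mulrC ler_wpM2l ?nrm_ge0.
have w2 : half *: (h * h + w * w) - w = 0.
  apply: (@nrm_small _ _ _ (2^-1 * (2^-1 + nrm w) + 1)) => e e0.
  have [n [nE nE']] := wsm _ e0.
  rewrite (le_trans (nrm_tri (sqrt_iter n.+1) _ _))// mulrDl lerD ?mul1r//.
  rewrite -scalerBr nrmZ cabs_half -mulrA ler_pM2l ?invr_gt0//.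
  rewrite opprD addrACA subrr add0r.
  rewrite (le_trans (nrm_tri (sqrt_iter n * w) _ _))// addrC mulrDl lerD//.
    rewrite -mulrBr (le_trans (nrmM _ _))// ler_pM ?nrm_ge0// nrm_dist//.
  by rewrite -mulrBl (le_trans (nrmM _ _))// mulrC ler_wpM2l ?nrm_ge0// nrm_dist.
exists (1 - w); split.
- by rewrite starD starN star1 ws.
- by rewrite mulrBr mulrBl mulr1 mul1r wh.
- have w2' : h * h + w * w = w + w.
    have := w2 => /eqP; rewrite subr_eq0 => /eqP {3 4}<-.
    by rewrite -scalerDl -rmorphD /= -mulr2n -[2^-1 *+ 2]mulr_natr mulVf ?scale1r.
  have -> : (1 - w) * (1 - w) = 1 - (w + w) + w * w.
    by rewrite mulrBr mulr1 mulrBl mul1r opprB opprD !addrA addrAC.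
  by rewrite addrCA w2' subrK.
Qed.

End SquareRoot.

Section HomBounded.
Local Open Scope complex_scope.
Context {R : realType} {A B : cstarAlgType R} (phi : {lrmorphism A -> B}).
Hypothesis phi_star : star_preserving phi.

Let hom_le1 (h : A) : star h = h -> nrm h <= 2^-1 -> nrm (phi h) <= 1.
Proof.
move=> hs hle; have [k [ks hk hhkk]] := sqrt_one_sub_sqr hs hle.
pose U := h + 'i *: k.
have ii : 'i^* = - 'i :> R[i] by apply/eqP; rewrite eq_complex /= oppr0 !eqxx.
have Us : star U = h - 'i *: k.
  by rewrite /U starD starZ hs ks /= -scaleNr; congr (_ + _ *: _).
have i2 : 'i * 'i = -1 :> R[i] by rewrite -expr2 sqr_i.
have UU : star U * U = 1.
  rewrite Us /U mulrDr !mulrBl -!scalerAl -!scalerAr scalerA i2 scaleN1r.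
  rewrite hk opprK -hhkk addrA; congr (_ + _).
  by rewrite addrAC -addrA subrr addr0.
have pU : nrm (phi U) <= 1.
  by apply: nrm_unitary; rewrite -phi_star -rmorphM /= UU rmorph1.
have pU' : nrm (phi (star U)) <= 1 by rewrite phi_star nrm_star.
have -> : h = (2^-1)%:C *: (U + star U).
  rewrite Us /U addrACA subrr addr0 scalerDr -scalerDl -rmorphD /=.
  by rewrite -mulr2n -[2^-1 *+ 2]mulr_natr mulVf ?scale1r.
rewrite linearZ /= rmorphD nrmZ cabs_real ger0_norm ?invr_ge0//.
rewrite mulrC ler_pdivrMr// mul1r.
by rewrite (le_trans (nrmD _ _))// (le_trans (lerD pU pU')).
Qed.

(** A self-adjoint h with norm at most 1/2 is the real part of the unitary U = h
    + ik, where k^2 = 1 - h^2. Unitaries are mapped to unitaries, which have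
    norm at most 1, so the image of h also has norm at most 1; the C*-identity
    extends the bound from self-adjoint elements to all. The constant 2 is not
    optimal, but it does not depend on the homomorphism. *)
Lemma star_hom_bounded a : nrm (phi a) <= 2 * nrm a.
Proof.
have selfadj (h : A) : star h = h -> nrm (phi h) <= 2 * nrm h.
  move=> hs; have [h0|h0] := eqVneq (nrm h) 0.
    by rewrite (nrm0_eq0 h0) rmorph0 !nrm0 mulr0.
  have hgt0 : 0 < nrm h by rewrite lt_def h0 nrm_ge0.
  pose r := (2 * nrm h)^-1.
  have r0 : 0 < r by rewrite invr_gt0 mulr_gt0.
  have rs : star (r%:C *: h) = r%:C *: h.
    by rewrite starZ hs conj_Creal// complex_real.
  have rh : nrm (r%:C *: h) <= 2^-1.
    by rewrite nrmZ cabs_real (gtr0_norm r0) /r invfM -mulrA mulVf// mulr1.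
  have := hom_le1 rs rh.
  rewrite linearZ /= nrmZ cabs_real (gtr0_norm r0) mulrC.
  by rewrite -ler_pdivlMr// div1r invrK.
rewrite -(@ler_pXn2r _ 2) ?nnegrE ?mulr_ge0 ?nrm_ge0//.
rewrite -nrm_starM -phi_star -rmorphM /= exprMn.
rewrite (le_trans (selfadj _ _)) ?starM ?starK// nrm_starM.
by rewrite ler_wpM2r ?exprn_ge0 ?nrm_ge0//; lra.
Qed.

End HomBounded.
(** * Lebesgue integrals of bounded functions *)

Section BoundedMeasurable.
Context d (T : measurableType d) (R : realType) (mu : probability T R).
Implicit Types f g : T -> R.

Definition bmeas f := measurable_fun setT f /\ exists M, forall x, `|f x| <= M.

Lemma bmeas_integrable f D : measurable D -> bmeas f ->
  mu.-integrable D (EFin \o f).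
Proof.
move=> mD [mf [M fM]]; apply: measurable_bounded_integrable => //.
- exact: le_lt_trans (probability_le1 _ mD) (ltry _).
- exact: measurable_funTS.
- exists M; split; first exact: num_real.
  by move=> M' MM' x _; apply: le_trans (fM x) (ltW MM').
Qed.

Lemma bmeas_cst r : bmeas (fun=> r).
Proof. by split; [exact: measurable_cst | exists `|r|]. Qed.

Lemma bmeasD f g : bmeas f -> bmeas g -> bmeas (fun x => f x + g x).
Proof.
move=> [mf [M fM]] [mg [N gN]]; split; first exact: measurable_funD.
by exists (M + N) => x; rewrite (le_trans (ler_normD _ _))// lerD.
Qed.

Lemma bmeasM f g : bmeas f -> bmeas g -> bmeas (fun x => f x * g x).
Proof.
move=> [mf [M fM]] [mg [N gN]]; split; first exact: measurable_funM.
by exists (M * N) => x; rewrite normrM ler_pM.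
Qed.

Lemma bmeas_sum I (r : seq I) (f : I -> T -> R) : (forall i, bmeas (f i)) ->
  bmeas (fun x => \sum_(i <- r) f i x).
Proof.
move=> bf; elim: r => [|i r IH].
  by under [X in bmeas X]eq_fun do rewrite big_nil; exact: bmeas_cst.
by under [X in bmeas X]eq_fun do rewrite big_cons; exact: bmeasD.
Qed.

Lemma RintD f g : bmeas f -> bmeas g ->
  \int[mu]_x (f x + g x) = \int[mu]_x f x + \int[mu]_x g x.
Proof. by move=> bf bg; rewrite RintegralD//; exact: bmeas_integrable. Qed.

Lemma RintZ r f : bmeas f -> \int[mu]_x (r * f x) = r * \int[mu]_x f x.
Proof. by move=> bf; rewrite RintegralZl//; exact: bmeas_integrable. Qed.

Lemma Rint_cst r : \int[mu]_x r = r.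
Proof.
rewrite Rintegral_cst// [X in fine X](_ : _ = 1%E) ?mulr1//.
exact: (@probability_setT _ _ _ mu).
Qed.

Lemma le_Rint f g : bmeas f -> bmeas g -> (forall x, f x <= g x) ->
  \int[mu]_x f x <= \int[mu]_x g x.
Proof. by move=> bf bg fg; apply: le_Rintegral => //; exact: bmeas_integrable. Qed.

Lemma Rint_sum I (r : seq I) (f : I -> T -> R) : (forall i, bmeas (f i)) ->
  \int[mu]_x (\sum_(i <- r) f i x) = \sum_(i <- r) \int[mu]_x f i x.
Proof.
move=> bf; elim: r => [|i r IH].
  by rewrite big_nil; under eq_Rintegral do rewrite big_nil; rewrite Rint_cst.
rewrite big_cons -IH -RintD//; last exact: bmeas_sum.
by apply: eq_Rintegral => x _; rewrite big_cons.
Qed.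

End BoundedMeasurable.

(** * Integrals of vector-valued simple functions *)

Section SimpleFunctions.
Local Open Scope complex_scope.
Context d (T : measurableType d) (R : realType) (mu : probability T R).
Variable V : completeNormedModType R[i].
Implicit Type s : seq (set T * V).

Definition simple_measurable s := forall Ev, Ev \in s -> measurable Ev.1.

Lemma simple_fun_cons E v s x :
  simple_fun ((E, v) :: s) x = (if x \in E then v else 0) + simple_fun s x.
Proof. by rewrite /simple_fun big_cons /=; case: ifP => // _; rewrite add0r. Qed.

Lemma simple_fun_cat s s' x :
  simple_fun (s ++ s') x = simple_fun s x + simple_fun s' x.
Proof. by rewrite /simple_fun big_cat. Qed.

Lemma simple_int_cat s s' :
  simple_int mu (s ++ s') = simple_int mu s + simple_int mu s'.
Proof. by rewrite /simple_int big_cat. Qed.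

Lemma simple_measurable_cat s s' : simple_measurable s -> simple_measurable s' ->
  simple_measurable (s ++ s').
Proof. by move=> ms ms' Ev; rewrite mem_cat => /orP[/ms|/ms']. Qed.

Lemma simple_measurable_cons E v s : simple_measurable ((E, v) :: s) ->
  measurable E /\ simple_measurable s.
Proof.
move=> ms; split; first exact: (ms (E, v) (mem_head _ _)).
by move=> Ev Evs; apply: ms; rewrite in_cons Evs orbT.
Qed.

Lemma bmeas_nrm_simple s w : simple_measurable s ->
  bmeas (fun x => nrm (w + simple_fun s x)).
Proof.
elim: s w => [|[E v] s IH] w ms.
  rewrite (_ : (fun x => _) = fun=> nrm w); first exact: bmeas_cst.
  by apply/funext => x; rewrite /simple_fun big_nil addr0.
have [mE {}ms] := simple_measurable_cons ms.
have [m1 [M1 b1]] := IH (w + v) ms; have [m2 [M2 b2]] := IH w ms.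
rewrite (_ : (fun x => _) = fun x =>
  if x \in E then nrm (w + v + simple_fun s x) else nrm (w + simple_fun s x)).
  split.
    apply: measurable_fun_ifT => //.
    apply: (measurable_fun_bool true).
    rewrite setTI (_ : _ @^-1` _ = E)//.
    by apply/seteqP; split => x /=; [exact: set_mem | exact: mem_set].
  exists (Num.max M1 M2) => x; case: ifP => _; rewrite le_max ?b1 ?b2 ?orbT//.
apply/funext => x; rewrite simple_fun_cons; case: ifP => _; first by rewrite addrA.
by rewrite add0r.
Qed.

Local Notation m D := ((fine (mu D))%:C : R[i]).

Let mDI D E : measurable D -> measurable E ->
  m D = m (D `&` E) + m (D `\` E).
Proof.
move=> mD mE; rewrite -rmorphD /=; congr (_%:C).
have mI := measurableI _ _ mD mE; have mm := measurableD mD mE.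
rewrite (measureDI mu mD mE) fineD ?fin_num_measure// addrC//.
Qed.

(** The sets in s may overlap. Localizing the estimate to D and allowing a
    constant term w makes an induction on s possible: the first set E splits D
    in two, and on D `&` E its vector is absorbed in w. *)
Let simple_int_le_on s D w : measurable D -> simple_measurable s ->
  nrm (m D *: w + \sum_(Ev <- s) m (D `&` Ev.1) *: Ev.2) <=
  \int[mu]_(x in D) nrm (w + simple_fun s x).
Proof.
elim: s D w => [|[E v] s IH] D w mD ms.
  rewrite big_nil addr0 nrmZ cabs_real ger0_norm ?fine_ge0// mulrC -Rintegral_cst//.
  by under [leRHS]eq_Rintegral do rewrite /simple_fun big_nil addr0.
have [mE {}ms'] := simple_measurable_cons ms.
have mI := measurableI _ _ mD mE; have mm := measurableD mD mE.
have DE : D = (D `&` E) `|` (D `\` E) by rewrite setUIDK.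
have -> : m D *: w + \sum_(Ev <- (E, v) :: s) m (D `&` Ev.1) *: Ev.2 =
   (m (D `&` E) *: (w + v) + \sum_(Ev <- s) m (D `&` E `&` Ev.1) *: Ev.2) +
   (m (D `\` E) *: w + \sum_(Ev <- s) m ((D `\` E) `&` Ev.1) *: Ev.2).
  rewrite big_cons /= (mDI mD mE) scalerDl scalerDr.
  have -> : \sum_(Ev <- s) m (D `&` Ev.1) *: Ev.2 =
      \sum_(Ev <- s) m (D `&` E `&` Ev.1) *: Ev.2 +
      \sum_(Ev <- s) m ((D `\` E) `&` Ev.1) *: Ev.2.
    rewrite -big_split /= [LHS]big_seq [RHS]big_seq; apply: eq_bigr => Ev Evs.
    rewrite -scalerDl; congr (_ *: _).
    rewrite (mDI (measurableI _ _ mD (ms' _ Evs)) mE).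
    by rewrite (setIAC D E) !setDE (setIAC D (~` E)).
  by rewrite (addrA (_ *: v)) addrACA (addrA (_ *: w)).  
rewrite (le_trans (nrmD _ _))// (le_trans (lerD (IH _ _ mI ms') (IH _ _ mm ms')))//.
rewrite [X in _ <= Rintegral _ X _]DE Rintegral_setU//; last 2 first.
- by rewrite -DE; apply: bmeas_integrable => //; exact: bmeas_nrm_simple.
- by apply/disj_setPS => x [[_ Ex] [_ nEx]].
rewrite le_eqVlt; apply/orP; left; apply/eqP; congr (_ + _); apply: eq_Rintegral => x.
  by rewrite in_setE => -[_ Ex]; rewrite simple_fun_cons mem_set// addrA.
by rewrite in_setE => -[_ Ex]; rewrite simple_fun_cons memNset// add0r.
Qed.

Lemma nrm_simple_int s : simple_measurable s ->
  nrm (simple_int mu s) <= \int[mu]_x nrm (simple_fun s x).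
Proof.
move=> ms; have := simple_int_le_on 0 measurableT ms.
rewrite scaler0 add0r; under eq_bigr do rewrite setTI.
by under [leRHS]eq_Rintegral do rewrite add0r.
Qed.

End SimpleFunctions.
(** * Integrals of uniform limits of simple functions *)

Section UniformIntegral.
Local Open Scope complex_scope.
Context d (T : measurableType d) (R : realType) (mu : probability T R).

(** Compatible with [is_bochner], but errors are bounded everywhere and not in
    mean, which makes stability under sums, bounded linear maps and uniform
    limits immediate, without measurability conditions on f. *)
Definition unif_int (V : completeNormedModType R[i]) (f : T -> V) (y : V) :=
  forall e : R, 0 < e -> exists s : seq (set T * V),
    [/\ simple_measurable s, forall x, nrm (f x - simple_fun s x) <= e
      & nrm (simple_int mu s - y) <= e].

Section Map.
Variables V W : completeNormedModType R[i].
Variable L : V -> W.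
Hypotheses (LD : {morph L : v w / v + w}) (LZ : forall c, {morph L : v / c *: v}).

Definition simple_map (s : seq (set T * V)) : seq (set T * W) :=
  [seq (Ev.1, L Ev.2) | Ev <- s].

Let L0 : L 0 = 0.
Proof. by rewrite -(scale0r 0) LZ scale0r. Qed.

Let LB v w : L (v - w) = L v - L w.
Proof. by rewrite LD -(scaleN1r w) LZ scaleN1r. Qed.

Lemma simple_measurable_map s : simple_measurable s -> simple_measurable (simple_map s).
Proof. by move=> ms _ /mapP[Ev Evs ->]; exact: (ms _ Evs). Qed.

Lemma simple_fun_map s x : simple_fun (simple_map s) x = L (simple_fun s x).
Proof.
rewrite /simple_fun big_map /=.
exact/esym/(big_morph L LD L0).
Qed.

Lemma simple_int_map s : simple_int mu (simple_map s) = L (simple_int mu s).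
Proof.
rewrite /simple_int big_map /= (big_morph L LD L0).
by apply: eq_bigr => Ev _; rewrite LZ.
Qed.

Lemma unif_int_lin (C : R) f y : (forall v, nrm (L v) <= C * nrm v) ->
  unif_int f y -> unif_int (fun x => L (f x)) (L y).
Proof.
move=> LC fy e e0; have C0 : 0 < `|C| + 1 by rewrite ltr_wpDl.
have [s [ms fs sy]] := fy _ (divr_gt0 e0 C0).
have Le v : nrm v <= e / (`|C| + 1) -> nrm (L v) <= e.
  move=> ve; rewrite (le_trans (LC v))//.
  apply: (@le_trans _ _ ((`|C| + 1) * nrm v)).
    by rewrite ler_wpM2r ?nrm_ge0// (le_trans (ler_norm _))// lerDl.
  by rewrite mulrC -ler_pdivlMr.
exists (simple_map s); split; first exact: simple_measurable_map.
  by move=> x; rewrite simple_fun_map -LB; exact: Le (fs x).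
by rewrite simple_int_map -LB; exact: Le sy.
Qed.

End Map.

Section Space.
Variable V : completeNormedModType R[i].
Implicit Types (f : T -> V) (y : V) (s : seq (set T * V)).

Lemma eq_unif_int f f' y : f =1 f' -> unif_int f y -> unif_int f' y.
Proof. by move=> /funext ->. Qed.

Lemma unif_int_scale c f y : unif_int f y -> unif_int (fun x => c *: f x) (c *: y).
Proof.
apply: (@unif_int_lin _ _ _ _ _ (cabs c)).
- by move=> v w; rewrite scalerDr.
- by move=> k v; rewrite !scalerA mulrC.
- by move=> v; rewrite nrmZ.
Qed.

Lemma unif_intD f f' y y' : unif_int f y -> unif_int f' y' ->
  unif_int (fun x => f x + f' x) (y + y').
Proof.
move=> fy fy' e e0; have e20 : 0 < e / 2 by rewrite divr_gt0.
have [s [ms fs sy]] := fy _ e20; have [s' [ms' fs' sy']] := fy' _ e20.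
exists (s ++ s'); split; first exact: simple_measurable_cat.
  move=> x; rewrite simple_fun_cat opprD addrACA [e]splitr.
  by rewrite (le_trans (nrmD _ _))// lerD.
by rewrite simple_int_cat opprD addrACA [e]splitr (le_trans (nrmD _ _))// lerD.
Qed.

Lemma unif_intN f y : unif_int f y -> unif_int (fun x => - f x) (- y).
Proof.
move=> /(unif_int_scale (-1)); rewrite scaleN1r.
by under [X in unif_int X]eq_fun do rewrite scaleN1r.
Qed.

Lemma unif_intB f f' y y' : unif_int f y -> unif_int f' y' ->
  unif_int (fun x => f x - f' x) (y - y').
Proof. by move=> fy /unif_intN; exact: unif_intD. Qed.

Lemma unif_int0 : unif_int (fun=> 0 : V) 0.
Proof.
move=> e e0; exists [::]; split => [//|x|].
  by rewrite /simple_fun big_nil subrr nrm0 ltW.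
by rewrite /simple_int big_nil subrr nrm0 ltW.
Qed.

Lemma unif_int_sum I (r : seq I) (f : I -> T -> V) (y : I -> V) :
  (forall i, unif_int (f i) (y i)) ->
  unif_int (fun x => \sum_(i <- r) f i x) (\sum_(i <- r) y i).
Proof.
move=> fy; elim: r => [|i r IH].
  by rewrite big_nil; under [X in unif_int X]eq_fun do rewrite big_nil; exact: unif_int0.
by rewrite big_cons; under [X in unif_int X]eq_fun do rewrite big_cons; exact: unif_intD.
Qed.

Let opp_map s := simple_map (fun v : V => - v) s.

Let simple_fun_opp s x : simple_fun (opp_map s) x = - simple_fun s x.
Proof. by apply: simple_fun_map => [v w|c v]; rewrite ?opprD// scalerN. Qed.

(** The difference of two integrals is the integral of a single concatenated
    list, so that the bound for one simple function applies. *)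
Lemma nrm_simple_int_sub s s' (k : T -> R) : simple_measurable s ->
  simple_measurable s' -> bmeas k ->
  (forall x, nrm (simple_fun s x - simple_fun s' x) <= k x) ->
  nrm (simple_int mu s - simple_int mu s') <= \int[mu]_x k x.
Proof.
move=> ms ms' bk sk.
have mo : simple_measurable (s ++ opp_map s').
  by apply: simple_measurable_cat => //; exact: simple_measurable_map.
have -> : simple_int mu s - simple_int mu s' = simple_int mu (s ++ opp_map s').
  rewrite simple_int_cat (simple_int_map (L := -%R))// => [v w|c v].
    by rewrite opprD.
  by rewrite scalerN.
rewrite (le_trans (nrm_simple_int _ mo))// le_Rint//.
  by have := bmeas_nrm_simple 0 mo; under [X in bmeas X]eq_fun do rewrite add0r.
by move=> x; rewrite simple_fun_cat simple_fun_opp.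
Qed.

Lemma nrm_unif_int f y (k : T -> R) : unif_int f y -> bmeas k ->
  (forall x, nrm (f x) <= k x) -> nrm y <= \int[mu]_x k x.
Proof.
move=> fy bk fk; apply/ler_addgt0Pr => e e0.
have e20 : 0 < e / 2 by rewrite divr_gt0.
have [s [ms fs sy]] := fy _ e20.
have -> : y = simple_int mu s - (simple_int mu s - y) by rewrite subKr.
rewrite [e]splitr addrA (le_trans (nrmB _ _))// lerD//.
have := @nrm_simple_int_sub s [::] (fun x => k x + e / 2) ms.
rewrite RintD ?Rint_cst//; last exact: bmeas_cst.
rewrite /simple_int big_nil subr0; apply => //.
  by apply: bmeasD => //; exact: bmeas_cst.
move=> x; rewrite /simple_fun big_nil subr0 -/(simple_fun s x).
by rewrite -[simple_fun s x](subKr (f x)) (le_trans (nrmB _ _))// lerD// fs.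
Qed.

(** Existence of integrals: this is where completeness of V enters. *)
Lemma unif_int_lim f : (forall e, 0 < e -> exists g y,
    unif_int g y /\ forall x, nrm (f x - g x) <= e) ->
  exists y, unif_int f y.
Proof.
move=> fg.
have fs e : 0 < e -> exists s, simple_measurable s /\
    forall x, nrm (f x - simple_fun s x) <= e.
  move=> e0; have e20 : 0 < e / 2 by rewrite divr_gt0.
  have [g [y [gy fgx]]] := fg _ e20; have [s [ms gs _]] := gy _ e20.
  exists s; split => // x; rewrite [e]splitr.
  by rewrite (le_trans (nrm_tri (g x) _ _))// lerD.
have pos n : 0 < (2^-1 : R) ^+ n by rewrite exprn_gt0// invr_gt0.
have /choice[s sP] n := fs _ (pos n).
have step n : nrm (simple_int mu (s n.+1) - simple_int mu (s n)) <= 2 * 2^-1 ^+ n.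
  have [ms fsn] := sP n; have [ms' fsn'] := sP n.+1.
  rewrite -[leRHS](Rint_cst mu); apply: nrm_simple_int_sub => //.
    exact: bmeas_cst.
  move=> x; rewrite (le_trans (nrm_tri (f x) _ _))// mulr_natl mulr2n lerD//.
  rewrite nrm_dist (le_trans (fsn' x))// exprS ler_piMl// ?exprn_ge0//.
  by rewrite invf_le1// ler1n.
have [y sy] := complete_fast step; exists y => e e0.
have [n ne] := half_small (2 * 2) e0.
have [ms fsn] := sP n; exists (s n); split => [//|x|]; last first.
  exact: le_trans (sy n) ne.
by rewrite (le_trans (fsn x))// (le_trans _ ne)// ler_peMl ?exprn_ge0// -natrM ler1n.
Qed.

(** The norm of f - s is a limit of norms of simple functions, hence it is
    measurable; this makes the integral of the norm in [is_bochner] monotone and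
    additive. *)
Lemma bmeas_nrm_sub_simple f y s : unif_int f y -> simple_measurable s ->
  bmeas (fun x => nrm (f x - simple_fun s x)).
Proof.
move=> fy ms; have pos n : 0 < (2^-1 : R) ^+ n by rewrite exprn_gt0// invr_gt0.
have /choice[t tP] n := fy _ (pos n).
pose g n x := nrm (0 + simple_fun (t n ++ opp_map s) x).
have gE n x : g n x = nrm (simple_fun (t n) x - simple_fun s x).
  by rewrite /g simple_fun_cat simple_fun_opp add0r.
have bg n : bmeas (g n).
  apply: bmeas_nrm_simple; apply: simple_measurable_cat.
    by have [] := tP n.
  exact: simple_measurable_map.
have fg n x : nrm (f x - simple_fun (t n) x) <= 2^-1 ^+ n by have [] := tP n.
split.
  apply: (@measurable_fun_cvg _ _ _ _ g) => [n|x _]; first exact: (bg n).1.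
  apply/cvgrPdist_le => e e0; have [N NE] := half_small 1 e0.
  exists N => // n /= Nn; rewrite gE (le_trans _ NE)// mul1r.
  apply: (@le_trans _ _ (2^-1 ^+ n)); last first.
    by rewrite ler_wiXn2l// ?invr_ge0// invf_le1// ler1n.
  rewrite (le_trans _ (fg n x))//.
  rewrite ler_norml; apply/andP; split; last by rewrite lerBlDr nrm_tri.
  by rewrite lerNl opprB lerBlDr (le_trans (nrm_tri (f x) _ _))// lerD// nrm_dist.
have [_ [M gM]] := bg 0%N; exists (1 + M) => x.
rewrite ger0_norm ?nrm_ge0// (le_trans (nrm_tri (simple_fun (t 0%N) x) _ _))//.
apply: lerD; first by have := fg 0%N x; rewrite expr0.
by rewrite -gE; apply: le_trans (ler_norm _) (gM x).
Qed.

Local Notation nu := (mu : {measure set T -> \bar R}).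

Let int_nrm_fin f y s : unif_int f y -> simple_measurable s ->
  (\int[nu]_x (complex.Re `|f x - simple_fun s x|)%:E)%E =
  (\int[mu]_x nrm (f x - simple_fun s x))%:E.
Proof.
move=> fy ms; rewrite /Rintegral fineK//; apply: integrable_fin_num => //.
exact: bmeas_integrable (bmeas_nrm_sub_simple fy ms).
Qed.

Lemma unif_int_bochner f y : unif_int f y -> is_bochner mu f y.
Proof.
move=> fy; have pos n : 0 < (2^-1 : R) ^+ n by rewrite exprn_gt0// invr_gt0.
have /choice[s sP] n := fy _ (pos n); exists s; split.
- by move=> n; have [] := sP n.
- move=> x; apply/cvg_nrmP => e e0; have [N NE] := half_small 1 e0.
  exists N => n Nn; rewrite nrm_dist; have [_ + _] := sP n => /(_ x)/le_trans; apply.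
  by rewrite (le_trans _ NE)// mul1r ler_wiXn2l// ?invr_ge0// invf_le1// ler1n.
- have ms : forall i, simple_measurable (s i) by move=> i; have [] := sP i.
  have intE : (fun i => (\int[nu]_x (complex.Re `|f x - simple_fun (s i) x|)%:E)%E)
      = EFin \o fun i => \int[mu]_x nrm (f x - simple_fun (s i) x).
    by apply/funext => i; exact: int_nrm_fin fy (ms i).
  rewrite intE.
  apply: cvg_EFin; first by apply: nearW.
  apply/cvgrPdist_le => e e0; have [N NE] := half_small 1 e0.
  exists N => // n /= Nn; rewrite sub0r normrN ger0_norm; last first.
    by apply: Rintegral_ge0 => x _; exact: nrm_ge0.
  apply: le_trans NE; rewrite mul1r.
  apply: (@le_trans _ _ (2^-1 ^+ n)); last first.
    by rewrite ler_wiXn2l// ?invr_ge0// invf_le1// ler1n.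
  rewrite -[leRHS](Rint_cst mu); apply: le_Rint.
  - exact: bmeas_nrm_sub_simple fy _.
  - exact: bmeas_cst.
  - by move=> x; have [] := sP n.
- apply/cvg_nrmP => e e0; have [N NE] := half_small 1 e0.
  exists N => n Nn; have [_ _] := sP n => /le_trans; apply.
  by rewrite (le_trans _ NE)// mul1r ler_wiXn2l// ?invr_ge0// invf_le1// ler1n.
Qed.

(** Uniqueness of the Bochner integral. A uniform approximation of f and an
    approximation of f in mean are close to each other in mean, hence so are
    their integrals. *)
Lemma bochner_unif_int f y y' : unif_int f y -> is_bochner mu f y' -> y = y'.
Proof.
move=> fy [s [ms _ fs sy]].
apply/eqP; rewrite -subr_eq0; apply/eqP; apply: (@nrm_small _ _ _ 4) => e e0.
have [t [mt ft ty]] := fy _ e0.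
move/cvg_nrmP/(_ _ e0) : sy => [N sN].
have [n [Nn fsn]] : exists n, (N <= n)%N /\ \int[mu]_x nrm (f x - simple_fun (s n) x) <= e.
  have intE : (fun i => (\int[nu]_x (complex.Re `|f x - simple_fun (s i) x|)%:E)%E)
      = EFin \o fun i => \int[mu]_x nrm (f x - simple_fun (s i) x).
    by apply/funext => i; exact: int_nrm_fin fy (ms i).
  move: fs; rewrite intE.
  move=> /fine_cvgP[_] /cvgrPdist_le/(_ _ e0)[N' _ N'P].
  exists (maxn N N'); split; first exact: leq_maxl.
  have /= := N'P (maxn N N') (leq_maxr _ _).
  by rewrite sub0r normrN; apply: le_trans; exact: ler_norm.
have bfs := bmeas_nrm_sub_simple fy (ms n).
have : nrm (simple_int mu t - simple_int mu (s n)) <= e + e.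
  apply: le_trans (lerD (lexx e) fsn).
  rewrite -[X in _ <= X + _](Rint_cst mu e) -RintD//; last first.
    exact: bmeas_cst.
  apply: nrm_simple_int_sub mt (ms n) _ _.
    by apply: bmeasD => //; exact: bmeas_cst.
  by move=> x; rewrite (le_trans (nrm_tri (f x) _ _))// lerD// nrm_dist.
move=> tsn.
rewrite (le_trans (nrm_tri (simple_int mu t) _ _))//.
have -> : 4 * e = e + (e + e + e) by ring.
rewrite lerD//; first by rewrite nrm_dist.
by rewrite (le_trans (nrm_tri (simple_int mu (s n)) _ _))// lerD// sN.
Qed.

End Space.
End UniformIntegral.
(** * Integrals of a scalar function times a vector *)

Section ScalarIntegrand.
Local Open Scope complex_scope.
Context d (T : measurableType d) (R : realType) (mu : probability T R).
Variable V : completeNormedModType R[i].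
Implicit Types (a : V) (r : T -> R) (c : T -> R[i]).

(** The sum counts the integers in [1, t], so it is the integer part of t.
    Written as a sum of indicators, it turns a function with values in [0, 1]
    into a simple function on overlapping sets. *)
Lemma staircase_approx (t : R) (N : nat) : 0 <= t <= N%:R ->
  `|t - \sum_(j < N) (j.+1%:R <= t)%R%:R| <= 1.
Proof.
elim: N => [|N IH] /andP[t0 tN].
  by rewrite big_ord0 subr0 ger0_norm// (le_trans tN).
have [tN'|tN'] := leP t N%:R.
  rewrite big_ord_recr /= [in X in _ + X](_ : (_ <= _) = false) ?addr0.
    by rewrite IH// t0.
  by apply/negbTE; rewrite -ltNge (le_lt_trans tN')// ltr_nat.
rewrite big_ord_recr /= (eq_bigr (fun=> 1)) => [|j _]; last first.
  by rewrite (le_trans _ (ltW tN'))// ler_nat.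
rewrite sumr_const card_ord.
move: tN; rewrite -natr1 => tN.
by case: (leP (N%:R + 1) t) => h /=; rewrite ler_norml; lra.
Qed.

Let unif_int_real01 r a : measurable_fun setT r -> (forall x, 0 <= r x <= 1) ->
  unif_int mu (fun x => (r x)%:C *: a) ((\int[mu]_x r x)%:C *: a).
Proof.
move=> mr r01 e e0; have [k kE] := half_small (nrm a) e0.
pose N := (2 ^ k)%N; have N0 : 0 < N%:R :> R by rewrite ltr0n expn_gt0.
have NE : N%:R^-1 = 2^-1 ^+ k :> R by rewrite /N natrX exprVn.
pose E (j : nat) := [set x | j.+1%:R <= N%:R * r x].
have mE j : measurable (E j).
  have mNr : measurable_fun setT (fun x => N%:R * r x) by apply: measurable_funM.
  have := mNr measurableT _ (measurable_itv `[j.+1%:R, +oo[).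
  rewrite setTI (_ : _ @^-1` _ = E j)//; apply/seteqP.
  by split => x; rewrite /= in_itv /= andbT.
pose q x : R := \sum_(j < N) N%:R^-1 * \1_(E j) x.
have bind j : bmeas (\1_(E j) : T -> R).
  split; first exact: measurable_indic.
  by exists 1 => x; rewrite indicE ger0_norm ?lern1 ?leq_b1.
have bterm j : bmeas (fun x => N%:R^-1 * \1_(E j) x : R).
  by apply: bmeasM => //; exact: bmeas_cst.
have bq : bmeas q by apply: bmeas_sum.
have br : bmeas r.
  by split=> //; exists 1 => x; have /andP[? ?] := r01 x; rewrite ger0_norm.
have rq x : `|r x - q x| <= N%:R^-1.
  have -> : r x - q x = N%:R^-1 * (N%:R * r x - \sum_(j < N) (j.+1%:R <= N%:R * r x)%R%:R).
    rewrite mulrBr mulKf ?gt_eqF// /q -mulr_sumr; congr (_ - _ * _).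
    apply: eq_bigr => j _; rewrite indicE; congr (nat_of_bool _)%:R.
    by apply/idP/idP => [/set_mem//|?]; exact: mem_set.
  rewrite normrM ger0_norm ?invr_ge0 ?ler0n// ler_piMr ?invr_ge0 ?ler0n//.
  apply: staircase_approx; have /andP[r0 r1] := r01 x.
  by rewrite mulr_ge0 ?ler0n//= ler_piMr ?ler0n.
pose s := [seq (E (nat_of_ord j), (N%:R^-1)%:C *: a) | j <- enum 'I_N].
have sE x : simple_fun s x = (q x)%:C *: a.
  rewrite /simple_fun big_map big_enum_cond /= /q rmorph_sum /= scaler_suml.
  rewrite big_mkcond /=; apply: eq_bigr => j _; rewrite indicE /=.
  by case: ifP => _; rewrite ?mulr1// mulr0 scale0r.
have sI : simple_int mu s = (\int[mu]_x q x)%:C *: a.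
  rewrite /simple_int big_map big_enum /= /q Rint_sum// rmorph_sum /= scaler_suml.
  apply: eq_bigr => j _; rewrite RintZ// scalerA -rmorphM /=; congr (_%:C *: _).
  by rewrite mulrC /Rintegral integral_indic// setIT.
have le1 (u : R) : `|u| <= N%:R^-1 -> nrm (u%:C *: a) <= e.
  move=> uN; rewrite nrmZ cabs_real (le_trans _ kE)// mulrC.
  by rewrite ler_wpM2l ?nrm_ge0// -NE.
exists s; split.
- by move=> _ /mapP[j _ ->] /=.
- by move=> x; rewrite sE -scalerBl -rmorphB /=; apply: le1; exact: rq.
- rewrite sI -scalerBl -rmorphB /=; apply: le1.
  have bqr : bmeas (fun x => q x + -1 * r x).
    by apply: bmeasD => //; apply: bmeasM => //; exact: bmeas_cst.
  have -> : \int[mu]_x q x - \int[mu]_x r x = \int[mu]_x (q x + -1 * r x).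
    by rewrite RintD ?RintZ ?mulN1r//; apply: bmeasM => //; exact: bmeas_cst.
  have bnorm : bmeas (fun x => `|q x + -1 * r x|).
    split; first exact: (measurableT_comp _ bqr.1).
    by have [_ [M hM]] := bqr; exists M => x; rewrite normr_id.
  apply: le_trans (le_normr_Rintegral measurableT (bmeas_integrable mu measurableT bqr)) _.
  rewrite -[leRHS](Rint_cst mu); apply: le_Rint => //; first exact: bmeas_cst.
  by move=> x; rewrite mulN1r distrC.
Qed.

Lemma unif_int_real r a : bmeas r ->
  unif_int mu (fun x => (r x)%:C *: a) ((\int[mu]_x r x)%:C *: a).
Proof.
move=> br; have [mr [M0 rM0]] := br; pose M := `|M0| + 1.
have M_gt0 : 0 < M by rewrite ltr_wpDl.
have rM x : `|r x| <= M.
  by rewrite (le_trans (rM0 x))// (le_trans (ler_norm _))// lerDl.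
pose r' x := (2 * M)^-1 * (r x + M).
have M2 : 0 < 2 * M by rewrite mulr_gt0.
have mr' : measurable_fun setT r'.
  by apply: measurable_funM => //; apply: measurable_funD.
have r'01 x : 0 <= r' x <= 1.
  have := rM x; rewrite ler_norml => /andP[h1 h2].
  apply/andP; split.
    by rewrite mulr_ge0 ?invr_ge0 ?(ltW M2)//; lra.
  by rewrite /r' mulrC ler_pdivrMr// mul1r; lra.
have br' : bmeas r'.
  by split => //; exists 1 => x; have /andP[? ?] := r'01 x; rewrite ger0_norm.
have rE x : r x = (2 * M) * r' x + - M.
  by rewrite /r' mulrA divff ?gt_eqF// mul1r addrK.
have cstP : unif_int mu (fun=> (- M)%:C *: a) ((- M)%:C *: a).
  move=> e e0; exists [:: (setT, (- M)%:C *: a)]; split.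
  - by move=> Ev; rewrite inE => /eqP ->; exact: measurableT.
  - by move=> x; rewrite simple_fun_cons /simple_fun big_nil in_setT addr0 subrr nrm0 ltW.
  - rewrite /simple_int big_seq1 /= [X in fine X](_ : _ = 1%E).
      by rewrite scale1r subrr nrm0 ltW.
    exact: (@probability_setT _ _ _ mu).
have := unif_intD (unif_int_scale (2 * M)%:C (unif_int_real01 a mr' r'01)) cstP.
have bM : bmeas (fun x => 2 * M * r' x) by apply: bmeasM => //; exact: bmeas_cst.
have -> : \int[mu]_x r x = 2 * M * \int[mu]_x r' x + - M.
  rewrite -RintZ// -[X in _ = _ + X](Rint_cst mu) -RintD//; last exact: bmeas_cst.
  by apply: eq_Rintegral => x _; rewrite rE.
rewrite scalerA -rmorphM -scalerDl -rmorphD /=.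
apply: eq_unif_int => x.
by rewrite scalerA -rmorphM -scalerDl -rmorphD /= -rE.
Qed.

Definition cbmeas c := bmeas (fun x => complex.Re (c x)) /\ bmeas (fun x => complex.Im (c x)).

Definition cint c : R[i] :=
  (\int[mu]_x complex.Re (c x))%:C + 'i%C * (\int[mu]_x complex.Im (c x))%:C.

Lemma unif_int_scalar c a : cbmeas c ->
  unif_int mu (fun x => c x *: a) (cint c *: a).
Proof.
move=> [bR bI]; have := unif_intD (unif_int_real a bR)
  (unif_int_scale 'i (unif_int_real a bI)).
rewrite scalerA -scalerDl -/(cint c).
apply: eq_unif_int => x.
by rewrite scalerA -scalerDl -complexE.
Qed.

Lemma cintZ z c : cbmeas c -> cint (fun x => z * c x) = z * cint c.
Proof.
move=> [bR bI]; have bM (k : R) f : bmeas f -> bmeas (fun x : T => k * f x).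
  by move=> bf; apply: bmeasM => //; exact: bmeas_cst.
have -> : cint (fun x => z * c x) =
  (\int[mu]_x (complex.Re z * complex.Re (c x) + - complex.Im z * complex.Im (c x)))%:C +
  'i%C * (\int[mu]_x (complex.Re z * complex.Im (c x) + complex.Im z * complex.Re (c x)))%:C.
  rewrite /cint; congr (_%:C + _ * _%:C); apply: eq_Rintegral => x _;
  by case: z (c x) => [p q] [a b] /=; rewrite ?mulNr.
rewrite !RintD ?RintZ//; [|exact: bM..].
rewrite /cint; case: z => p q /=.
by apply/eqP; rewrite eq_complex /=; apply/andP; split; apply/eqP; ring.
Qed.

End ScalarIntegrand.
(** * Haar measure on the dual group *)

Section DualMeasure.
Local Open Scope complex_scope.
Context (R : realType) (H : groupType).
Implicit Types (chi psi : dual R H) (y : H).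

Lemma dual_eval_continuous y : continuous (fun chi : dual R H => chi y : R[i]^o).
Proof.
move=> chi.
pose ev := (fun chi => (dual_fun chi : prod_topology (fun _ : H => R[i]^o))).
apply: (@continuous_comp _ _ _ ev (fun f => f y)).
  exact: initial_continuous.
exact: (@proj_continuous H (fun=> R[i]^o) y).
Qed.

Lemma dual_translate_continuous psi :
  continuous (fun chi : dual R H => (psi * chi)%g : dual R H).
Proof.
have cont y : continuous (fun chi : dual R H => (psi * chi)%g y : R[i]^o).
  move=> chi; rewrite /=.
  apply: (@continuous_comp _ _ _ (fun chi : dual R H => chi y : R[i]^o)
    (fun z => psi y * z : R[i]^o)); first exact: dual_eval_continuous.
  exact: mulrl_continuous.
apply: continuous_comp_initial => chi.
have FF : Filter (dual_fun ((psi * x)%g : dual R H) @[x --> chi]).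
  by apply: fmap_filter; exact: nbhs_filter.
apply/cvg_sup => y.
apply: (@continuous_comp_initial _ _ _ _
  (fun chi : dual R H => dual_fun (psi * chi)%g)).
exact: cont.
Qed.

Lemma Re_continuous : continuous (@complex.Re R : R[i]^o -> R).
Proof.
move=> z U /nbhs_ballP[e /= e0 eU]; exists e%:C => [|w /= zw] /=; first by rewrite ltcR.
apply: eU; rewrite -ball_normE /= -ltcR; apply: le_lt_trans zw.
by apply: le_trans (normc_ge_Re (z - w)); rewrite raddfB.
Qed.

Lemma Im_continuous : continuous (@complex.Im R : R[i]^o -> R).
Proof.
move=> z; rewrite (_ : @complex.Im R = @complex.Re R \o (fun z : R[i]^o => - 'i%C * z)); last first.
  by apply/funext => w; rewrite /= mulNr raddfN /= mulrC ReiNIm opprK.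
apply: (@continuous_comp _ _ _ (fun z : R[i]^o => - 'i%C * z : R[i]^o)
  (@complex.Re R : R[i]^o -> R)); first exact: mulrl_continuous.
exact: Re_continuous.
Qed.

Local Notation D := (borel (dual R H)).

Lemma borel_continuous_measurable (f : dual R H -> R) : continuous f ->
  measurable_fun [set: D] (f : D -> R).
Proof.
move=> /continuousP cf; apply: (measurability _ (RGenOInfty.measurableE R)) => //.
move=> _ [_ [a ->] <-]; rewrite setTI; apply: sub_sigma_algebra.
by apply: cf; rewrite set_itvE; exact: open_gt.
Qed.

Lemma dual_translate_measurable psi :
  measurable_fun [set: D] ((fun chi : dual R H => (psi * chi)%g) : D -> D).
Proof.
have /continuousP ct := @dual_translate_continuous psi.
apply: (@measurability _ _ D D setT _ (@open (dual R H))) => [|_ [U oU <-]]//.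
by rewrite setTI; apply: sub_sigma_algebra; exact: ct.
Qed.

Lemma cbmeas_dual y : cbmeas (fun chi : D => (chi : dual R H) y).
Proof.
have le1 (z : R[i]) : `|z| = 1 -> `|complex.Re z| <= 1 /\ `|complex.Im z| <= 1.
  move=> z1; split; first by rewrite -lecR (le_trans (normc_ge_Re z))// z1.
  rewrite -normrN -ReiNIm -lecR (le_trans (normc_ge_Re _))// normrM z1 mul1r.
  by rewrite normc_def /= expr0n expr1n add0r sqrtr1.
split; split.
- apply: borel_continuous_measurable => chi.
  apply: (@continuous_comp _ _ _ (fun chi : dual R H => chi y : R[i]^o)
    (@complex.Re R : R[i]^o -> R)); first exact: dual_eval_continuous.
  exact: Re_continuous.
- by exists 1 => chi; have [] := le1 _ (dual_norm chi y).
- apply: borel_continuous_measurable => chi.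
  apply: (@continuous_comp _ _ _ (fun chi : dual R H => chi y : R[i]^o)
    (@complex.Im R : R[i]^o -> R)); first exact: dual_eval_continuous.
  exact: Im_continuous.
- by exists 1 => chi; have [] := le1 _ (dual_norm chi y).
Qed.

Variables (mu : probability D R) (Hmu : is_haar mu).

Lemma haar_translate psi (r : D -> R) : bmeas r ->
  \int[mu]_chi r ((psi * (chi : dual R H))%g : D) = \int[mu]_chi r chi.
Proof.
move=> br; have mt := dual_translate_measurable psi.
rewrite /Rintegral; congr fine.
have brt : bmeas (r \o ((fun chi : dual R H => (psi * chi)%g) : D -> D)).
  split; first exact: measurableT_comp br.1 mt.
  by have [_ [M hM]] := br; exists M => x; exact: hM.
have := @integral_pushforward _ _ _ _ R _ mt mu setT (EFin \o r) _ _ measurableT.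
rewrite preimage_setT => <-.
- by apply: eq_measure_integral => E mE _; exact: Hmu.
- by apply/measurable_EFinP; exact: br.1.
- exact: bmeas_integrable measurableT brt.
Qed.

(** Translating by psi multiplies the character chi |-> chi y by psi y and
    preserves its integral, so the integral is 0 as soon as some psi y differs
    from 1. Otherwise the character is constant with integral 1; the integral is
    nonnegative in both cases. *)
Lemma haar_character y : (forall psi : dual R H, psi y = 1) \/
  cint mu (fun chi => (chi : dual R H) y) = 0.
Proof.
have [?|/existsNP[psi psiy]] := pselect (forall psi : dual R H, psi y = 1).
  by left.
right; set c := cint _ _; have [bR bI] := cbmeas_dual y.
have inv : psi y * c = c.
  rewrite -cintZ; last exact: cbmeas_dual.
  rewrite /c /cint -[in RHS](haar_translate psi bR) -[in RHS](haar_translate psi bI).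
  by [].
apply/eqP; have /eqP := inv; rewrite -subr_eq0 -[X in _ - X]mul1r -mulrBl mulf_eq0 subr_eq0.
by case/orP => // /eqP.
Qed.

End DualMeasure.

(** * Fejer kernels *)

Section PositiveKernels.
Local Open Scope complex_scope.
Context (R : realType) (H : groupType).
Local Notation D := (borel (dual R H)).
Implicit Types (chi : dual R H) (x y : H) (s : seq H).

(** Sums of characters with nonnegative integer coefficients: they are closed
    under products and conjugation, and their integrals are nonnegative. *)
Definition char_sum (c : dual R H -> R[i]) :=
  exists Y : seq H, forall chi, c chi = \sum_(y <- Y) chi y.

Lemma cabs_sqr (z : R[i]) : (cabs z ^+ 2)%:C = z * z^*.
Proof. by rewrite rmorphXn /= -cabsE -normCK. Qed.

Lemma cabs_ge0 (z : R[i]) : 0 <= cabs z.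
Proof. by rewrite -ler0c -cabsE. Qed.

Lemma cabs_sqrE (z : R[i]) : cabs z ^+ 2 = complex.Re z ^+ 2 + complex.Im z ^+ 2.
Proof. by apply: complexI; rewrite add_Re2_Im2 rmorphXn /= -cabsE. Qed.

Lemma dual_conj chi y : (chi y)^* = chi y^-1%g.
Proof.
apply: (mulfI (dual_neq0 chi y)).
by rewrite -normCK dual_norm expr1n -dualM mulgV dual1.
Qed.

Lemma char_sum_eval y : char_sum (fun chi => chi y).
Proof. by exists [:: y] => chi; rewrite big_seq1. Qed.

Lemma char_sum1 : char_sum (fun=> 1).
Proof. by exists [:: 1%g] => chi; rewrite big_seq1 dual1. Qed.

Lemma char_sum0 : char_sum (fun=> 0).
Proof. by exists [::] => chi; rewrite big_nil. Qed.

Lemma char_sumD c c' : char_sum c -> char_sum c' ->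
  char_sum (fun chi => c chi + c' chi).
Proof. by move=> [Y cY] [Z cZ]; exists (Y ++ Z) => chi; rewrite big_cat cY cZ. Qed.

Lemma char_sumM c c' : char_sum c -> char_sum c' ->
  char_sum (fun chi => c chi * c' chi).
Proof.
move=> [Y cY] [Z cZ]; exists [seq (y * z)%g | y <- Y, z <- Z] => chi.
rewrite big_allpairs_dep cY cZ mulr_suml; apply: eq_bigr => y _.
by rewrite mulr_sumr; apply: eq_bigr => z _; rewrite dualM.
Qed.

Lemma char_sumX c n : char_sum c -> char_sum (fun chi => c chi ^+ n).
Proof.
move=> cc; elim: n => [|n IH]; first exact: char_sum1.
by under [X in char_sum X]eq_fun do rewrite exprS; exact: char_sumM.
Qed.

Lemma char_sum_conj c : char_sum c -> char_sum (fun chi => (c chi)^*).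
Proof.
move=> [Y cY]; exists [seq (y^-1)%g | y <- Y] => chi.
rewrite big_map cY rmorph_sum /=; apply: eq_bigr => y _.
exact: dual_conj.
Qed.

Lemma char_sum_sum I (r : seq I) (p : pred I) (c : I -> dual R H -> R[i]) :
  (forall i, char_sum (c i)) -> char_sum (fun chi => \sum_(i <- r | p i) c i chi).
Proof.
move=> cc; elim: r => [|i r IH].
  by under [X in char_sum X]eq_fun do rewrite big_nil; exact: char_sum0.
under [X in char_sum X]eq_fun do rewrite big_cons.
by case: (p i) => //; exact: char_sumD.
Qed.

(** Up to the factor 1/N, the pullback under chi |-> chi x of the Fejer kernel
    of the circle. *)
Definition fejer N x chi : R := cabs (\sum_(n < N) chi x ^+ n) ^+ 2.

Definition fejer_prod N s chi : R := \prod_(x <- s) fejer N x chi.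

Lemma fejer_ge0 N x chi : 0 <= fejer N x chi.
Proof. exact: sqr_ge0. Qed.

Lemma fejer_prod_ge0 N s chi : 0 <= fejer_prod N s chi.
Proof. by apply: prodr_ge0 => x _; exact: fejer_ge0. Qed.

(** The geometric sum: multiplication by |1 - chi x|^2 collapses the kernel to
    |1 - (chi x)^N|^2. *)
Lemma fejer_geom N x chi : cabs (1 - chi x) ^+ 2 * fejer N x chi <= 4.
Proof.
have geom : (1 - chi x) * (\sum_(n < N) chi x ^+ n) = 1 - chi x ^+ N.
  by rewrite -[RHS]opprB subrX1 -mulNr opprB.
rewrite /fejer -exprMn -cabsM geom (_ : 4 = 2 ^+ 2); last by rewrite -natrX.
rewrite ler_pXn2r ?nnegrE ?cabs_ge0//.
rewrite -lecR -cabsE (le_trans (ler_normB _ _))//.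
by rewrite normr1 normrX dual_norm expr1n (rmorph_nat (real_complex R)).
Qed.

(** Expanding the square, the N diagonal terms are all 1 and the other ones are
    characters. *)
Lemma fejer_split N x : char_sum (fun chi => (fejer N x chi - N%:R)%:C).
Proof.
pose off chi := \sum_(n < N) \sum_(m < N | m != n) chi x ^+ n * (chi x ^+ m)^*.
rewrite (_ : (fun chi => _) = off).
  apply: char_sum_sum => n; apply: char_sum_sum => m; apply: char_sumM.
    exact/char_sumX/char_sum_eval.
  exact/char_sum_conj/char_sumX/char_sum_eval.
apply/funext => chi; rewrite rmorphB /= cabs_sqr rmorph_sum /= mulr_suml.
rewrite (_ : N%:R%:C = \sum_(n < N) 1); last first.
  by rewrite sumr_const card_ord (rmorph_nat (real_complex R)).
rewrite -sumrB; apply: eq_bigr => n _; rewrite mulr_sumr (bigD1 n) //=.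
by rewrite -normCK normrX dual_norm !expr1n addrAC subrr add0r.
Qed.

Lemma char_sum_fejer N x : char_sum (fun chi => (fejer N x chi)%:C).
Proof.
rewrite (_ : (fun chi => _) = fun chi =>
    \sum_(n < N) chi x ^+ n * (\sum_(n < N) chi x ^+ n)^*).
  apply: char_sum_sum => n; apply: char_sumM; first exact/char_sumX/char_sum_eval.
  by apply/char_sum_conj/char_sum_sum => m; exact/char_sumX/char_sum_eval.
by apply/funext => chi; rewrite cabs_sqr mulr_suml.
Qed.

Lemma char_sum_fejer_prod N s : char_sum (fun chi => (fejer_prod N s chi)%:C).
Proof.
elim: s => [|x s IH].
  rewrite (_ : (fun chi => _) = fun=> 1); first exact: char_sum1.
  by apply/funext => chi; rewrite /fejer_prod big_nil.
rewrite (_ : (fun chi => _) = fun chi => (fejer N x chi)%:C * (fejer_prod N s chi)%:C).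
  exact: char_sumM (char_sum_fejer N x) IH.
by apply/funext => chi; rewrite -rmorphM /fejer_prod big_cons.
Qed.

Section Haar.
Variables (mu : probability D R) (Hmu : is_haar mu).

Lemma char_sum_cbmeas (c : dual R H -> R[i]) : char_sum c -> cbmeas (c : D -> R[i]).
Proof.
move=> [Y cY]; split.
  rewrite (_ : (fun chi => _) = fun chi : D => \sum_(y <- Y) complex.Re ((chi : dual R H) y)).
    by apply: bmeas_sum => y; exact: (cbmeas_dual R y).1.
  by apply/funext => chi; rewrite cY raddf_sum.
rewrite (_ : (fun chi => _) = fun chi : D => \sum_(y <- Y) complex.Im ((chi : dual R H) y)).
  by apply: bmeas_sum => y; exact: (cbmeas_dual R y).2.
by apply/funext => chi; rewrite cY raddf_sum.
Qed.

Lemma char_sum_bmeas (f : dual R H -> R) : char_sum (fun chi => (f chi)%:C) ->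
  bmeas (f : D -> R).
Proof. by move=> /char_sum_cbmeas[]. Qed.

Lemma Rint_char_ge0 y : 0 <= \int[mu]_chi complex.Re ((chi : dual R H) y).
Proof.
case: (haar_character Hmu y) => [y1|].
  by under eq_Rintegral do rewrite y1; rewrite Rint_cst.
by rewrite /cint => /(congr1 (@complex.Re R)) /=; rewrite !mul0r mul1r oppr0 !addr0 => ->.
Qed.

Lemma Rint_char_sum_ge0 (f : dual R H -> R) : char_sum (fun chi => (f chi)%:C) ->
  0 <= \int[mu]_chi f chi.
Proof.
move=> [Y fY].
have -> : \int[mu]_chi f chi =
    \int[mu]_chi (\sum_(y <- Y) complex.Re ((chi : dual R H) y)).
  apply: eq_Rintegral => chi _; rewrite -raddf_sum -fY//.
rewrite Rint_sum; last by move=> y; exact: (cbmeas_dual R y).1.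
by apply: sumr_ge0 => y _; exact: Rint_char_ge0.
Qed.

(** By [fejer_split], the factor at x is N plus a sum of characters, whose
    product with the remaining factors has a nonnegative integral. *)
Lemma Rint_fejer_prod_cons N x s :
  N%:R * \int[mu]_chi fejer_prod N s chi <= \int[mu]_chi fejer_prod N (x :: s) chi.
Proof.
have bs := char_sum_bmeas (char_sum_fejer_prod N s).
have bxs := char_sum_bmeas (char_sum_fejer_prod N (x :: s)).
pose g chi := (fejer N x chi - N%:R) * fejer_prod N s chi.
have cg : char_sum (fun chi => (g chi)%:C).
  rewrite (_ : (fun chi => _) = fun chi =>
      (fejer N x chi - N%:R)%:C * (fejer_prod N s chi)%:C).
    exact: char_sumM (fejer_split N x) (char_sum_fejer_prod N s).
  by apply/funext => chi; rewrite -rmorphM.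
have -> : \int[mu]_chi fejer_prod N (x :: s) chi =
    \int[mu]_chi (N%:R * fejer_prod N s chi + g chi).
  by apply: eq_Rintegral => chi _; rewrite /g /fejer_prod big_cons; ring.
rewrite RintD ?RintZ//.
- by rewrite lerDl Rint_char_sum_ge0.
- by apply: bmeasM => //; exact: bmeas_cst.
- exact: char_sum_bmeas.
Qed.

Lemma Rint_fejer_prod_gt0 N s : (0 < N)%N -> 0 < \int[mu]_chi fejer_prod N s chi.
Proof.
move=> N0; elim: s => [|x s IH].
  by under eq_Rintegral do rewrite /fejer_prod big_nil; rewrite Rint_cst.
by rewrite (lt_le_trans _ (Rint_fejer_prod_cons N x s))// mulr_gt0// ltr0n.
Qed.

Lemma bmeas_cabs_sub x : bmeas (fun chi : D => cabs (1 - (chi : dual R H) x) ^+ 2).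
Proof.
rewrite (_ : (fun chi => _) = fun chi : D => 2 + -2 * complex.Re ((chi : dual R H) x)).
  apply: bmeasD; first exact: bmeas_cst.
  apply: bmeasM; first exact: bmeas_cst.
  exact: (cbmeas_dual R x).1.
apply/funext => chi; have := cabs_sqrE ((chi : dual R H) x).
rewrite cabs1 ?dual_norm// expr1n cabs_sqrE raddfB [complex.Im (_ - _)]raddfB /=.
by move=> h; lra.
Qed.

(** In mean, the product kernel only sees the chi with chi x close to 1, for
    each x in s: the numerator loses the factor at x by [fejer_geom], while the
    denominator gains N from it by [Rint_fejer_prod_cons]. Normalizing by the
    integral of the kernel avoids computing it, although relations between the
    elements of s may make it large. *)
Lemma fejer_prod_concentrated N s x : (0 < N)%N -> x \in s ->
  \int[mu]_chi (cabs (1 - (chi : dual R H) x) ^+ 2 * fejer_prod N s chi) <=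
  4 / N%:R * \int[mu]_chi fejer_prod N s chi.
Proof.
move=> N0 xs; pose s' := rem x s.
have KE chi : fejer_prod N s chi = fejer_prod N (x :: s') chi.
  exact/perm_big/perm_to_rem.
have bs' := char_sum_bmeas (char_sum_fejer_prod N s').
apply: (@le_trans _ _ (4 * \int[mu]_chi fejer_prod N s' chi)).
  rewrite -RintZ//; apply: le_Rint.
  - apply: bmeasM; first exact: bmeas_cabs_sub.
    exact: char_sum_bmeas (char_sum_fejer_prod N s).
  - by apply: bmeasM => //; exact: bmeas_cst.
  - move=> chi; rewrite KE /fejer_prod big_cons mulrA -/(fejer_prod N s' chi).
    by rewrite ler_wpM2r ?fejer_prod_ge0 ?fejer_geom.
rewrite -mulrA ler_pM2l// ler_pdivlMl ?ltr0n//.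
under [leRHS]eq_Rintegral do rewrite KE.
exact: Rint_fejer_prod_cons.
Qed.

End Haar.
End PositiveKernels.
(** * Fractions in lowest terms *)

Section Fractions.
Variable P : comMonoidType.
Hypothesis HP : right_LCM P.

(** Write the fraction as p / q and let p q' = q p' be the least common multiple
    of p and q; then p / q = p' / q', and a common multiple of p' and q' that
    were not a multiple of p' q' would give a common multiple of p and q that is
    not one of p q'. *)
Lemma perp_fraction (x : groth P) :
  exists p q : P, perp (p, q) /\ groth_in p = (x * groth_in q)%g.
Proof.
elim/grothW: x => -[p q]; have cancel := rlcm_cancel HP.
have [empty|[r pqr]] := rlcm_lcm HP p q.
  have : (principal p `&` principal q) (p * q)%g.
    by split; [exists q | exists p; rewrite // mulgC].
  by rewrite empty.
have : principal r r by exists 1%g; rewrite ?mulg1.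
rewrite -pqr => -[[q' _ pq'] [p' _ qp']]; exists p', q'; split; last first.
  rewrite /groth_in [RHS]groth_mul_pi; apply/eqP/groth_eqP; exists 1%g => /=.
  by rewrite !mul1g !mulg1 mulgC qp' -pq'.
apply/seteqP; split => z /=; last first.
  move=> [t _ <-]; split; first by exists (q' * t)%g; rewrite ?mulgA.
  by exists (p' * t)%g; rewrite // mulgA (mulgC q').
move=> [[v _ <-] [w _ vw]].
have pvqw : (q * w = p * v)%g.
  by apply: (cancel p'); rewrite !mulgA (mulgC p' q) qp' -pq' (mulgC p') -!mulgA vw.
have : principal r (p * v)%g.
  by rewrite -pqr; split; [exists v | exists w].
move=> [t _]; rewrite -pq' -mulgA => /cancel q't; exists t => //.
by rewrite /= -mulgA q't.
Qed.
End Fractions.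

(** * Fourier analysis of the gauge action *)

Section GaugeFourier.
Local Open Scope complex_scope.
Context (R : realType) (G : groupType) (P : comMonoidType)
  (theta : P -> G -> G) (A : cstarAlgType R) (u : G -> A) (s : P -> A).
Hypothesis HA : boundary_quotient theta u s.
Variable gamma : gauge_group R P -> {lrmorphism A -> A}.
Hypothesis Hgamma : gauge_action u s gamma.
Local Notation H := (groth P).
Local Notation D := (borel (gauge_group R P)).
Implicit Types (x y : H) (a b : A).

Let rep := bq_rep HA.

(** The spectral subspace of gamma at x. *)
Definition spectral x b := forall chi, gamma chi b = chi x *: b.

Lemma spectral_u g : spectral 1%g (u g).
Proof.
move=> chi; have := gauge_gen Hgamma chi g 1%g.
by rewrite (br_s1 rep) mulr1.
Qed.

Lemma spectral_s p : spectral (groth_in p) (s p).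
Proof.
move=> chi; have := gauge_gen Hgamma chi 1%g p.
by rewrite (br_u1 rep) mul1r.
Qed.

Lemma spectralM x y a b : spectral x a -> spectral y b -> spectral (x * y)%g (a * b).
Proof.
move=> xa yb chi.
by rewrite rmorphM /= xa yb -scalerAl -scalerAr scalerA dualM.
Qed.

Lemma spectral_star x a : spectral x a -> spectral x^-1%g (star a).
Proof.
move=> xa chi; rewrite (gauge_star Hgamma) xa starZ; congr (_ *: _).
exact: dual_conj.
Qed.

Lemma spectralZ x c a : spectral x a -> spectral x (c *: a).
Proof. by move=> xa chi; rewrite linearZ /= xa !scalerA mulrC. Qed.

Definition spectral_seq (bs : seq (H * A)) :=
  forall xb, xb \in bs -> spectral xb.1 xb.2.

Definition spectral_span a :=
  exists2 bs, spectral_seq bs & a = \sum_(xb <- bs) xb.2.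

Lemma spectral_span1 x a : spectral x a -> spectral_span a.
Proof.
move=> xa; exists [:: (x, a)]; last by rewrite big_seq1.
by move=> xb; rewrite inE => /eqP ->.
Qed.

Lemma spectral_spanD a b : spectral_span a -> spectral_span b -> spectral_span (a + b).
Proof.
move=> [bs hbs ->] [cs hcs ->]; exists (bs ++ cs); last by rewrite big_cat.
by move=> xb; rewrite mem_cat => /orP[/hbs|/hcs].
Qed.

Lemma spectral_spanM a b : spectral_span a -> spectral_span b -> spectral_span (a * b).
Proof.
move=> [bs hbs ->] [cs hcs ->].
exists [seq ((xb.1 * yc.1)%g, xb.2 * yc.2) | xb <- bs, yc <- cs].
  move=> _ /allpairsP[[xb yc] [/hbs xb1 /hcs yc1 ->]] /=.
  exact: spectralM.
rewrite big_allpairs_dep mulr_suml; apply: eq_bigr => xb _.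
by rewrite mulr_sumr.
Qed.

Lemma spectral_spanZ c a : spectral_span a -> spectral_span (c *: a).
Proof.
move=> [bs hbs ->]; exists [seq (xb.1, c *: xb.2) | xb <- bs].
  by move=> _ /mapP[xb /hbs xb1 ->] /=; exact: spectralZ.
by rewrite big_map scaler_sumr.
Qed.

Lemma spectral_span_star a : spectral_span a -> spectral_span (star a).
Proof.
move=> [bs hbs ->]; exists [seq ((xb.1^-1)%g, star xb.2) | xb <- bs].
  by move=> _ /mapP[xb /hbs xb1 ->] /=; exact: spectral_star.
by rewrite big_map (big_morph _ (@starD R A) star0).
Qed.

(** The closure of the span of the spectral subspaces is a closed *-subalgebra
    that contains the generators. *)
Lemma spectral_span_dense a (e : R) : 0 < e ->
  exists2 b, spectral_span b & nrm (a - b) <= e.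
Proof.
pose S : set A := [set a | forall e : R, 0 < e -> exists2 b, spectral_span b & nrm (a - b) <= e].
have spanS b : spectral_span b -> S b.
  by move=> sb e' e'0; exists b; rewrite // subrr nrm0 ltW.
have closedS : closed_star_subalgebra S.
  split.
  - move=> v vS e' e'0; have e'20 : 0 < e' / 2 by rewrite divr_gt0.
    have [|w [Sw vw]] := vS (ball v (e' / 2)%:C).
      by apply: nbhsx_ballx; rewrite ltcR.
    have [b sb wb] := Sw _ e'20; exists b => //.
    rewrite [e']splitr (le_trans (nrm_tri w _ _))// lerD//.
    by move: vw; rewrite -ball_normE /= nrmE ltcR => /ltW.
  - move=> v w Sv Sw e' e'0; have e'20 : 0 < e' / 2 by rewrite divr_gt0.
    have [b sb vb] := Sv _ e'20; have [c sc wc] := Sw _ e'20.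
    exists (b + c); first exact: spectral_spanD.
    by rewrite opprD addrACA [e']splitr (le_trans (nrmD _ _))// lerD.
  - move=> c v Sv e' e'0; have c0 : 0 < cabs c + 1 by rewrite ltr_wpDl ?cabs_ge0.
    have [b sb vb] := Sv _ (divr_gt0 e'0 c0).
    exists (c *: b); first exact: spectral_spanZ.
    rewrite -scalerBr nrmZ (le_trans (ler_wpM2l (cabs_ge0 c) vb))//.
    by rewrite mulrCA ler_piMr ?(ltW e'0)// ler_pdivrMr// mul1r lerDl.
  - move=> v w Sv Sw e' e'0.
    pose C := nrm v + nrm w + 1.
    have C0 : 0 < C by rewrite ltr_wpDl// addr_ge0 ?nrm_ge0.
    pose d := Num.min 1 (e' / C).
    have d0 : 0 < d by rewrite lt_min ltr01 divr_gt0.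
    have [b sb vb] := Sv _ d0; have [c sc wc] := Sw _ d0.
    exists (b * c); first exact: spectral_spanM.
    have cw : nrm c <= nrm w + 1.
      rewrite -[c](subKr w) (le_trans (nrmB _ _))// lerD// (le_trans wc)//.
      by rewrite ge_min lexx.
    rewrite (le_trans (nrm_tri (v * c) _ _))// -mulrBr -mulrBl.
    apply: (@le_trans _ _ (nrm v * d + d * (nrm w + 1))).
      by rewrite lerD// (le_trans (nrmM _ _))// ler_pM ?nrm_ge0.
    rewrite mulrC -mulrDr addrA -/C -ler_pdivlMr// ge_min lexx orbT//.
  - move=> v Sv e' e'0; have [b sb vb] := Sv _ e'0.
    exists (star b); first exact: spectral_span_star.
    by rewrite -starN -starD nrm_star.
have ST : S = setT.
  apply: (bq_generated HA closedS) => [g|p]; apply: spanS.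
    exact: spectral_span1 (spectral_u g).
  exact: spectral_span1 (spectral_s p).
have : S a by rewrite ST.
exact.
Qed.

Lemma gamma_bounded chi a : nrm (gamma chi a) <= 2 * nrm a.
Proof. exact/star_hom_bounded/(gauge_star Hgamma). Qed.

Section Haar.
Variables (mu : probability D R) (Hmu : is_haar mu).

(** The orbit of a linear combination of spectral elements is a trigonometric
    polynomial, hence integrable; as the gamma chi are uniformly bounded, all
    orbits are uniform limits of such. *)
Lemma gauge_orbit_integrable a :
  exists v, unif_int mu (fun chi : D => gamma chi a) v.
Proof.
apply: unif_int_lim => e e0; have e20 : 0 < e / 2 by rewrite divr_gt0.
have [_ [bs hbs ->] ab] := spectral_span_dense a e20.
exists (fun chi : D => \sum_(xb <- bs) (chi : gauge_group R P) xb.1 *: xb.2).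
exists (\sum_(xb <- bs) cint mu (fun chi : D => (chi : gauge_group R P) xb.1) *: xb.2).
split.
  by apply: unif_int_sum => xb; apply: unif_int_scalar; exact: cbmeas_dual.
move=> chi; have -> : \sum_(xb <- bs) (chi : gauge_group R P) xb.1 *: xb.2 =
    gamma chi (\sum_(xb <- bs) xb.2).
  rewrite linear_sum big_seq [RHS]big_seq; apply: eq_bigr => xb /hbs xb1.
  exact/esym/xb1.
by rewrite -rmorphB (le_trans (gamma_bounded _ _))// mulrC -ler_pdivlMr.
Qed.

(** [bochner] is 0 by convention on functions that are not integrable; since
    orbits are integrable, the vanishing of gauge_F is a genuine vanishing of an
    integral. *)
Lemma gauge_F_eq0 p q a : gauge_F s mu gamma p q a = 0 ->
  unif_int mu (fun chi : D => gamma chi (s p * a * star (s q))) 0.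
Proof.
have [y fy] := gauge_orbit_integrable (s p * a * star (s q)).
rewrite /gauge_F /bochner; case: xgetP => [z -> fz|]; last first.
  by move=> /(_ y) []; exact: unif_int_bochner.
by move=> z0; rewrite -z0 -(bochner_unif_int fy fz).
Qed.

(** For x = p / q the integrand of gauge_F is chi x *: (s p * gamma chi a * star
    (s q)), and the isometries s p and s q can be removed by multiplying with
    star (s p) on the left and with s q on the right. *)
Lemma fourier_coef_eq0 (HP : right_LCM P) a :
  (forall p q : P, perp (p, q) -> gauge_F s mu gamma p q a = 0) ->
  forall x, unif_int mu (fun chi : D => (chi : gauge_group R P) x *: gamma chi a) 0.
Proof.
move=> Fa x; have [p [q [pq xq]]] := perp_fraction HP x.
pose L v := star (s p) * v * s q.
have LD : {morph L : v w / v + w} by move=> v w; rewrite /L mulrDr mulrDl.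
have LZ c : {morph L : v / c *: v} by move=> v; rewrite /L -scalerAr -scalerAl.
have LC v : nrm (L v) <= nrm (star (s p)) * nrm (s q) * nrm v.
  by rewrite (le_trans (nrmM _ _))// mulrAC ler_wpM2r ?nrm_ge0// nrmM.
have := unif_int_lin LD LZ LC (gauge_F_eq0 (Fa _ _ pq)).
rewrite {2}/L mulr0 mul0r; apply: eq_unif_int => chi.
have ss r : star (s r) * s r = 1 by exact: br_isometry rep r.
rewrite /L !rmorphM /= (gauge_star Hgamma) !spectral_s starZ.
rewrite -!scalerAl -!scalerAr -!scalerAl !scalerA.
rewrite -!mulrA ss mulr1 !mulrA ss mul1r xq dualM; congr (_ *: _).
by rewrite -mulrA -normCK dual_norm expr1n mulr1.
Qed.

(** Integrating the orbit of a against a kernel K gives 0, so (\int K) a is the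
    integral of K (a - gamma_chi a). When b = sum_i b_i is a spectral
    approximation of a, with b_i at x_i, the difference a - gamma_chi a is at
    most 3 |a - b| + sum_i |1 - chi x_i| |b_i| in norm, and a kernel
    concentrated where all chi x_i are close to 1 makes the last sum small in
    mean. *)
Lemma fourier_uniqueness a :
  (forall x, unif_int mu (fun chi : D => (chi : gauge_group R P) x *: gamma chi a) 0) ->
  a = 0.
Proof.
move=> coef0; apply: (@nrm_small _ _ _ 4) => e e0.
have [_ [bs hbs ->] ab] := spectral_span_dense a e0; set b := \sum_(_ <- bs) _ in ab.
pose B := \sum_(xb <- bs) nrm xb.2.
have [n nE] := half_small (5 * B) e0.
pose m : R := 2 ^+ n; have m0 : 0 < m by rewrite exprn_gt0.
(* the order of the kernel is m^2: the mean of |1 - chi x_i| is then at most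
   1/m + m * 4/m^2 = 5/m *)
pose N := ((2 ^ n) * (2 ^ n))%N.
have N0 : (0 < N)%N by rewrite muln_gt0 expn_gt0.
have NE : N%:R = m * m :> R by rewrite natrM natrX.
pose xs := [seq xb.1 | xb <- bs].
pose K (chi : D) := fejer_prod N xs chi; pose J := \int[mu]_chi K chi.
pose K' x (chi : D) := cabs (1 - (chi : gauge_group R P) x) ^+ 2 * K chi.
have bK : bmeas K := char_sum_bmeas (char_sum_fejer_prod R N xs).
have bK' x : bmeas (K' x) by apply: bmeasM => //; exact: bmeas_cabs_sub.
have J0 : 0 < J := Rint_fejer_prod_gt0 Hmu xs N0.
have Kgamma : unif_int mu (fun chi : D => (K chi)%:C *: gamma chi a) 0.
  have [Y KY] := char_sum_fejer_prod R N xs.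
  have := unif_int_sum Y coef0; rewrite big1_eq.
  by apply: eq_unif_int => chi; rewrite -scaler_suml -KY.
have Ka : unif_int mu (fun chi : D => (K chi)%:C *: (a - gamma chi a)) (J%:C *: a).
  have := unif_intB (unif_int_real mu a bK) Kgamma; rewrite subr0.
  by apply: eq_unif_int => chi; rewrite scalerBr.
pose kappa chi := 3 * e * K chi +
  \sum_(xb <- bs) nrm xb.2 * (m^-1 * K chi + m * K' xb.1 chi).
have bZ (k : R) f : bmeas f -> bmeas (fun chi : D => k * f chi).
  by move=> bf; apply: bmeasM => //; exact: bmeas_cst.
have bterm (xb : H * A) : bmeas (fun chi => m^-1 * K chi + m * K' xb.1 chi).
  by apply: bmeasD; apply: bZ.
have bkappa : bmeas kappa.
  by apply: bmeasD; [exact: bZ|apply: bmeas_sum => xb; exact: bZ].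
have le_kappa chi : nrm ((K chi)%:C *: (a - gamma chi a)) <= kappa chi.
  have K0 : 0 <= K chi by exact: fejer_prod_ge0.
  rewrite nrmZ cabs_real ger0_norm//.
  have -> : kappa chi = K chi * (e + \sum_(xb <- bs) nrm xb.2 *
      (m^-1 + m * cabs (1 - (chi : gauge_group R P) xb.1) ^+ 2) + 2 * e).
    rewrite /kappa /K' [in RHS]addrAC mulrDr mulr_sumr; congr (_ + _); first by ring.
    by apply: eq_bigr => xb _; ring.
  rewrite ler_wpM2l//.
  rewrite (le_trans (nrm_tri (gamma chi b) _ _))// lerD//; last first.
    by rewrite -rmorphB (le_trans (gamma_bounded _ _))// ler_pM2l// nrm_dist.
  rewrite (le_trans (nrm_tri b _ _))// lerD//.
  have -> : b - gamma chi b = \sum_(xb <- bs) (1 - (chi : gauge_group R P) xb.1) *: xb.2.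
    rewrite /b linear_sum -sumrB big_seq [RHS]big_seq; apply: eq_bigr => xb /hbs xb1.
    by rewrite scalerBl scale1r; congr (_ - _); exact: xb1.
  rewrite (le_trans (nrm_sum _ _))// ler_sum// => xb _.
  rewrite nrmZ mulrC ler_wpM2l ?nrm_ge0//; set t := cabs _.
  (* t <= 1/m + m t^2, to pass from |1 - chi x_i| to its square *)
  rewrite -(ler_pM2l m0) mulrDr divff ?gt_eqF// mulrCA expr2 mulrA.
  have := sqr_ge0 (m * t - 1 / 2); lra.
have := nrm_unif_int Ka bkappa le_kappa.
rewrite nrmZ cabs_real gtr0_norm// => Jle.
have : \int[mu]_chi kappa chi <= J * (4 * e).
  rewrite RintD ?RintZ//; [|exact: bZ|by apply: bmeas_sum => xb; exact: bZ].
  rewrite Rint_sum; last by move=> xb; exact: bZ.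
  have sum_le : \sum_(xb <- bs) \int[mu]_chi (nrm xb.2 * (m^-1 * K chi + m * K' xb.1 chi))
      <= J * (5 * B * 2^-1 ^+ n).
    rewrite /B mulr_sumr mulr_suml mulr_sumr big_seq [leRHS]big_seq.
    apply: ler_sum => xb xbs; rewrite RintZ// RintD ?RintZ//; [|exact: bZ..].
    have xin : xb.1 \in xs by exact: map_f.
    have := fejer_prod_concentrated Hmu N0 xin; rewrite -/J NE => concentrated.
    have -> : J * (5 * nrm xb.2 * 2^-1 ^+ n) = nrm xb.2 * (m^-1 * J + m * (4 / (m * m) * J)).
      by rewrite exprVn -/m; field; rewrite gt_eqF.
    by rewrite ler_wpM2l ?nrm_ge0// lerD2l ler_pM2l.
  have := le_trans sum_le (ler_wpM2l (ltW J0) nE).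
  by rewrite -/J; lra.
by move=> /(le_trans Jle); rewrite ler_pM2l.
Qed.

End Haar.
End GaugeFourier.

Theorem lemma4p4 (R : realType) (G : groupType) (P : comMonoidType)
    (theta : P -> G -> G) (Hads : algebraic_dynamical_system theta)
    (Hcap : \bigcap_(p in [set: P]) range (theta p) = [set 1%g])
    (A : cstarAlgType R) (u : G -> A) (s : P -> A)
    (HA : boundary_quotient theta u s)
    (gamma : gauge_group R P -> {lrmorphism A -> A})
    (Hgamma : gauge_action u s gamma)
    (mu : probability (borel (gauge_group R P)) R) (Hmu : is_haar mu)
    (a : A) :
  (forall p q : P, perp (p, q) -> gauge_F s mu gamma p q a = 0) -> a = 0.
Proof.
move=> Fa; apply: (fourier_uniqueness HA Hgamma Hmu).
exact: (fourier_coef_eq0 HA Hgamma (ads_right_LCM Hads) Fa).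
Qed.
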